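(* Let $\mathcal{A}$ be a finite or countable alphabet, $\Omega=\mathcal{A}^{\mathbb{N}}$, $\sigma$ the left shift on $\Omega$, and $\mathbb{P}$ a $\sigma$-invariant probability measure on $\Omega$. (1) If $\underline{H}_2>0$, then for $\mathbb{P}\otimes\mathbb{P}$-almost every $(x,y)\in\Omega\times\Omega$, $$\limsup_{n\to+\infty}\frac{M_n(x,y)}{\log n}\le\frac{2}{\underline{H}_2}.$$ (2) Moreover, if $\underline{H}_2>0$ and if the system is $\alpha$-mixing with an exponential decay, or if it is $\psi$-mixing with $\psi(g)=g^{-a}$ for some $a>0$, then for $\mathbb{P}\otimes\mathbb{P}$-almost every $(x,y)\in\Omega\times\Omega$, $$\liminf_{n\to+\infty}\frac{M_n(x,y)}{\log n}\ge\frac{2}{\overline{H}_2}.$$ (3) Furthermore, if under the hypotheses of (2) the R\'enyi entropy $H_2$ exists, then for $\mathbb{P}\otimes\mathbb{P}$-almost every $(x,y)\in\Omega\times\Omega$, $$\lim_{n\to+\infty}\frac{M_n(x,y)}{\log n}=\frac{2}{H_2}.$$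
   Context: For $x,y\in\Omega$, $$M_n(x,y)=\max\{m: x_{i+k}=y_{j+k}\text{ for }k=1,\dots,m\text{ and for some }1\le i,j\le n-m\}.$$ For $y\in\Omega$, $C_n(y)=\{z\in\Omega: z_i=y_i\text{ for all }0\le i\le n-1\}$ is the $n$-cylinder containing $y$, and $\mathcal{F}_0^n$ is the $\sigma$-algebra over $\Omega$ generated by all $n$-cylinders. The lower and upper R\'enyi entropies are $$\underline{H}_2=\liminf_{k\to+\infty}\frac{\log\sum\mathbb{P}(C_k)^2}{-k},\qquad \overline{H}_2=\limsup_{k\to+\infty}\frac{\log\sum\mathbb{P}(C_k)^2}{-k},$$ where the sums are over all $k$-cylinders $C_k$. When the limit exists, it is denoted $H_2$ (the R\'enyi entropy). The system is $\alpha$-mixing if there is a function $\alpha:\mathbb{N}\to\mathbb{R}$ with $\alpha(g)\to0$ as $g\to+\infty$ such that for all $m,n,g\in\mathbb{N}$, $A\in\mathcal{F}_0^n$ and $B\in\mathcal{F}_0^m$, $$|\mathbb{P}(A\cap\sigma^{-g-n}B)-\mathbb{P}(A)\mathbb{P}(B)|\le\alpha(g).$$ It is $\alpha$-mixing with an exponential decay if $\alpha(g)$ decreases exponentially fast to $0$. The system is $\psi$-mixing if there is a function $\psi:\mathbb{N}\to\mathbb{R}$ with $\psi(g)\to0$ as $g\to+\infty$ such that for all $m,n,g\in\mathbb{N}$, $A\in\mathcal{F}_0^n$ and $B\in\mathcal{F}_0^m$, $$|\mathbb{P}(A\cap\sigma^{-g-n}B)-\mathbb{P}(A)\mathbb{P}(B)|\le\psi(g)\,\mathbb{P}(A)\mathbb{P}(B).$$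 When $\psi(g)=g^{-a}$ the condition is understood for $g\ge1$. *)

(* Defs.v *)
From HB Require Import structures.
From mathcomp Require Import all_boot all_order all_algebra.
From mathcomp Require Import all_classical all_reals all_analysis.
Import Order.TTheory GRing.Theory Num.Theory.
Import numFieldNormedType.Exports.

Set Implicit Arguments.
Unset Strict Implicit.
Unset Printing Implicit Defensive.

Local Open Scope classical_set_scope.
Local Open Scope ring_scope.

Definition cylinder (A : Type) (n : nat) (y : nat -> A) : set (nat -> A) :=
  [set z | forall i, (i < n)%N -> z i = y i].

Definition cylinders (A : Type) (n : nat) : set (set (nat -> A)) :=
  range (cylinder n).

(* Under the discrete sigma-algebra on a countable alphabet, the cylinders
   of all lengths generate the product sigma-algebra. *)
Definition shift_space (A : pointedType) : Type :=
  g_sigma_algebraType (\bigcup_n @cylinders A n).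

HB.instance Definition _ (A : pointedType) :=
  Measurable.on (shift_space A).

Definition cylinder_algebra (A : Type) (n : nat) : set (set (nat -> A)) :=
  <<s @cylinders A n >>.

Definition left_shift (A : Type) (x : nat -> A) : nat -> A := fun i => x i.+1.

Definition shift_invariant (A : pointedType) (R : realType)
    (P : probability (shift_space A) R) : Prop :=
  forall B : set (shift_space A), measurable B ->
    P (@left_shift A @^-1` B) = P B.

(* For n = 0 there are no admissible positions, and the value is 0. *)
Definition common_match (A : eqType) (n : nat) (x y : nat -> A) : nat :=
  \max_(m < n.+1 | [exists i : 'I_n.+1, exists j : 'I_n.+1,
      [&& (1 <= i <= n - m)%N, (1 <= j <= n - m)%N &
          all (fun k => x (i + k)%N == y (j + k)%N) (iota 1 m)]]) m.

(* At n = 0 and n = 1 this is a division by ln n = 0, whose value is 0. *)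
Definition match_rate (A : eqType) (R : realType) (x y : nat -> A)
    (n : nat) : \bar R :=
  ((common_match n x y)%:R / ln (n%:R : R))%:E.

(* The series lies in ]0, 1], so that [fine] loses nothing. *)
Definition renyi_rate (A : pointedType) (R : realType)
    (P : probability (shift_space A) R) (k : nat) : \bar R :=
  (ln (fine (\esum_(C in @cylinders A k) (P C ^+ 2)%E)) / - k%:R)%:E.

(* Entropies are extended reals: with an infinite alphabet the rate may a priori
   be unbounded, and then 2 / +oo = 0. *)
Definition lower_renyi (A : pointedType) (R : realType)
    (P : probability (shift_space A) R) : \bar R := limn_einf (renyi_rate P).

Definition upper_renyi (A : pointedType) (R : realType)
    (P : probability (shift_space A) R) : \bar R := limn_esup (renyi_rate P).

(* The Renyi entropy; meaningful only if [cvgn (renyi_rate P)]. *)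
Definition renyi (A : pointedType) (R : realType)
    (P : probability (shift_space A) R) : \bar R := limn (renyi_rate P).

Definition alpha_mixing_with (A : pointedType) (R : realType)
    (P : probability (shift_space A) R) (alpha : nat -> R) : Prop :=
  alpha @ \oo --> (0 : R) /\
  forall (m n g : nat) (E F : set (shift_space A)),
    cylinder_algebra n E -> cylinder_algebra m F ->
    (`|P (E `&` iter (g + n) (@left_shift A) @^-1` F) - P E * P F|
       <= (alpha g)%:E)%E.

Definition exponential_decay (R : realType) (u : nat -> R) : Prop :=
  exists C lambda : R, 0 < lambda /\
    forall g, `|u g| <= C * expR (- (lambda * g%:R)).

Definition exp_alpha_mixing (A : pointedType) (R : realType)
    (P : probability (shift_space A) R) : Prop :=
  exists alpha : nat -> R, alpha_mixing_with P alpha /\ exponential_decay alpha.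

(* psi-mixing with rate function psi, the inequality being required for the
   gaps g >= g0; plain psi-mixing is the case g0 = 0. *)
Definition psi_mixing_from (A : pointedType) (R : realType) (g0 : nat)
    (P : probability (shift_space A) R) (psi : nat -> R) : Prop :=
  psi @ \oo --> (0 : R) /\
  forall (m n g : nat) (E F : set (shift_space A)), (g0 <= g)%N ->
    cylinder_algebra n E -> cylinder_algebra m F ->
    (`|P (E `&` iter (g + n) (@left_shift A) @^-1` F) - P E * P F|
       <= (psi g)%:E * (P E * P F))%E.

(* The rate g^-a is undefined at g = 0, hence the bound g >= 1. *)
Definition poly_psi_mixing (A : pointedType) (R : realType)
    (P : probability (shift_space A) R) : Prop :=
  exists a : R, 0 < a /\ psi_mixing_from 1 P (fun g => (g%:R : R) `^ (- a)).

(* Main.v *)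
Require Import Defs.
From HB Require Import structures.
From mathcomp Require Import all_boot all_order all_algebra.
From mathcomp Require Import all_classical all_reals all_analysis.
From mathcomp Require Import measurable_realfun.
From mathcomp Require Import zify ring lra.
Import Order.TTheory GRing.Theory Num.Theory.
Import numFieldNormedType.Exports.

(** Write [S_r] for the sum of [P C ^+ 2] over the cylinders of length [r].
    Two independent points of law [P] carry the same word of length [r] at
    given positions [i] and [j] with probability exactly [S_r], by invariance
    ([measure_hit]), and the Renyi rates say that [S_r] is roughly
    [expR (- (H * r))]. There are about [n ^ 2] pairs of positions, so a
    common word of length [r] should exist as soon as [n ^ 2 * S_r] is
    large, that is for [r] up to [2 * ln n / H].

    Upper bound. By the union bound, a match of length [r] has probability at
    most [n ^ 2 * S_r] ([measure_match_set_le]). Along [n = 2 ^ k],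
    with [r > c * k] and [c > 2 * ln 2 / lower_renyi], this decays
    geometrically in [k], and the Borel-Cantelli lemma applies. As
    [common_match] is nondecreasing in [n], the values at powers of two
    control all the others ([dyadic_limn_esup]).

    Lower bound. Let [N] count the pairs of positions that carry a match of
    length [r <= c * k], with [c < 2 * ln 2 / upper_renyi]. Its
    mean is [(n - r) ^ 2 * S_r], and the probability that [N] vanishes
    is at most its variance over the square of its mean ([second_moment]). The
    second moment is a sum over two pairs [(i, j)] and [(i', j')]
    ([measure_hitI_le]). If [i] is far from [i'] and [j] from [j'], mixing
    makes the two matches almost independent, and the contribution is close to
    [S_r ^ 2]. If only one of the two couples is far apart, the contribution
    is at most about the sum of the cubes [P C ^+ 3], which is at most the
    power [3 / 2] of [S_r]. If none is, the trivial bound [S_r] suffices,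
    since there are only about [n ^ 2] such choices, up to the square of the
    gap. Both mixing hypotheses allow a gap that grows slower than any
    prescribed power of [n] and an error that is small enough ([fast_mixing]).
    The vanishing probability again decays geometrically in [k]
    ([measure_no_match_set_le]), and Borel-Cantelli and monotonicity conclude.

    Countability of the alphabet serves to encode words by natural numbers
    ([code]): probabilities on the product space then become sums over [nat]
    or over pairs of natural numbers ([measure_coincidence]). When the limit
    of the Renyi rates exists, both entropies are equal to it and the two
    bounds squeeze the matching rate. *)

Set Implicit Arguments.
Unset Strict Implicit.
Unset Printing Implicit Defensive.

Local Open Scope classical_set_scope.
Local Open Scope ring_scope.

(** * Longest common words *)

Definition match_at (A : Type) (r i j : nat) (x y : nat -> A) : Prop :=
  forall k, (k < r)%N -> x (i + k)%N = y (j + k)%N.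

Lemma common_matchP (A : eqType) (m : nat) (x y : nat -> A) (i j : nat) :
  reflect (match_at m i.+1 j.+1 x y)
    (all (fun k => x (i + k)%N == y (j + k)%N) (iota 1 m)).
Proof.
apply: (iffP allP) => [h k km|h k].
  by rewrite !addSnnS; apply/eqP/h; rewrite mem_iota; lia.
rewrite mem_iota => /andP[k1 km]; apply/eqP.
by have := h k.-1; rewrite !addSnnS prednK// => -> //; lia.
Qed.

(** A match longer than [r] can be truncated: this only enlarges the range of
    admissible positions. *)
Lemma common_match_geP (A : eqType) (n r : nat) (x y : nat -> A) :
  (0 < r)%N -> (r <= common_match n x y)%N ->
  exists i j, [/\ (1 <= i <= n - r)%N, (1 <= j <= n - r)%N &
                  match_at r i.+1 j.+1 x y].
Proof.
move=> r0; rewrite /common_match => rM.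
pose Q (m : 'I_n.+1) := [exists i : 'I_n.+1, exists j : 'I_n.+1,
      [&& (1 <= i <= n - m)%N, (1 <= j <= n - m)%N &
          all (fun k => x (i + k)%N == y (j + k)%N) (iota 1 m)]].
have [m Qm rm] : exists2 m : 'I_n.+1, Q m & (r <= m)%N.
  apply: contrapT => noex; move: rM; apply/negP; rewrite -ltnNge.
  rewrite -[X in (_ < X)%N](prednK r0) ltnS; apply/bigmax_leqP => m Qm.
  rewrite -ltnS prednK// ltnNge; apply/negP => rm; apply: noex.
  by exists m.
move: Qm => /existsP[i /existsP[j /and3P[hi hj /common_matchP h]]].
exists i, j; split; [lia|lia|].
by move=> k kr; apply: h; lia.
Qed.

Lemma common_match_ge (A : eqType) (n r : nat) (x y : nat -> A) (i j : nat) :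
  (1 <= i <= n - r)%N -> (1 <= j <= n - r)%N -> match_at r i.+1 j.+1 x y ->
  (r <= common_match n x y)%N.
Proof.
move=> hi hj h.
have rn : (r < n.+1)%N by lia.
have im : (i < n.+1)%N by lia.
have jm : (j < n.+1)%N by lia.
apply: (@leq_bigmax_cond _ _ (fun m : 'I_n.+1 => m : nat) (Ordinal rn)).
apply/existsP; exists (Ordinal im); apply/existsP; exists (Ordinal jm) => /=.
by rewrite hi hj; exact/common_matchP.
Qed.

Lemma common_match_mono (A : eqType) (x y : nat -> A) :
  {homo (fun n => common_match n x y) : m n / (m <= n)%N}.
Proof.
move=> m n mn; case: (posnP (common_match m x y)) => [->//|M0].
have [i [j [hi hj h]]] := common_match_geP M0 (leqnn _).
by apply: (common_match_ge (i := i) (j := j)) => //; lia.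
Qed.

(** * Upper and lower limits along powers of two *)

Section limits.
Variable R : realType.
Implicit Types (u : (\bar R)^nat) (c : \bar R).
Local Open Scope ereal_scope.

Lemma limn_esup_le_near u c : (\forall n \near \oo, u n <= c) ->
  limn_esup u <= c.
Proof.
move=> [N _ uN]; rewrite limn_esup_lim.
apply: lime_le; first exact: is_cvg_esups.
exists N => // n /= Nn; apply: ge_ereal_sup => _ [m /= nm <-].
by apply: uN => /=; exact: leq_trans nm.
Qed.

Lemma limn_einf_ge_near u c : (\forall n \near \oo, c <= u n) ->
  c <= limn_einf u.
Proof.
move=> [N _ uN]; rewrite limn_einf_lim.
apply: lime_ge; first exact: is_cvg_einfs.
exists N => // n /= Nn; apply: le_ereal_inf_tmp => _ [m /= nm <-].
by apply: uN => /=; exact: leq_trans nm.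
Qed.

Lemma lt_limn_einf_near u c : c < limn_einf u -> \forall n \near \oo, c < u n.
Proof.
rewrite limn_einf_lim (cvg_lim _ (@cvg_einfs_sup _ u))// => /ereal_sup_gt.
move=> [_ [n _ <-] cn]; exists n => // m /= nm; apply: (lt_le_trans cn).
by apply: ereal_inf_lbound; exists m.
Qed.

Lemma limn_esup_lt_near u c : limn_esup u < c -> \forall n \near \oo, u n < c.
Proof.
rewrite limn_esup_lim (cvg_lim _ (@cvg_esups_inf _ u))// => /ereal_inf_lt.
move=> [_ [n _ <-] cn]; exists n => // m /= nm; apply: le_lt_trans cn.
by apply: ereal_sup_ubound; exists m.
Qed.

Local Close Scope ereal_scope.

Lemma trunc_log2_near (K : nat) : \forall n \near \oo,
  [/\ (K <= trunc_log 2 n)%N, (2 ^ trunc_log 2 n <= n)%N &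
      (n < 2 ^ (trunc_log 2 n).+1)%N].
Proof.
exists (2 ^ K)%N => // n /= Kn; have n0 : (0 < n)%N.
  by apply: leq_trans Kn; rewrite expn_gt0.
by split; [exact: trunc_log_max|exact: trunc_logP|exact: trunc_log_ltn].
Qed.

Lemma ln_pow2 (k : nat) : ln ((2 ^ k)%N%:R : R) = k%:R * ln 2.
Proof. by rewrite natrX lnXn// mulr_natl. Qed.

Lemma ln2_gt0 : 0 < ln 2 :> R.
Proof. by rewrite ln_gt0// ltr1n. Qed.

(** For [2 ^ k <= n < 2 ^ k.+1] one has
    [M n <= M (2 ^ k.+1) <= c * k.+1], while
    [ln n >= k * ln 2]: passing to the next power of two costs a factor
    [k.+1 / k], which tends to [1]. *)
Lemma dyadic_limn_esup (M : nat -> nat) (c : R) :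
  {homo M : m n / (m <= n)%N} -> 0 <= c ->
  (\forall k \near \oo, (M (2 ^ k)%N)%:R <= c * k%:R) ->
  (limn_esup (fun n => ((M n)%:R / ln (n%:R : R))%:E) <= (c / ln 2)%:E)%E.
Proof.
move=> Mmono c0 [K _ hK]; apply/lee_addgt0Pr => e e0.
apply: limn_esup_le_near.
have l2 := ln2_gt0.
(* For [K' <= k], the excess [c / (k * ln 2)] is at most [e]. *)
pose K' := (maxn K (Num.truncn (c / (e * ln 2))).+1).
near=> n.
have [Kk kn nk] : [/\ (K' <= trunc_log 2 n)%N, (2 ^ trunc_log 2 n <= n)%N &
      (n < 2 ^ (trunc_log 2 n).+1)%N] by near: n; exact: trunc_log2_near.
move: Kk kn nk; set k := trunc_log 2 n => Kk kn nk.
rewrite geq_max in Kk; move/andP : Kk => [Kk Ck].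
have k0 : 0 < k%:R :> R by rewrite ltr0n; lia.
have ck : c / (e * ln 2) <= k%:R.
  rewrite ltW// (lt_le_trans (truncnS_gt _))// ler_nat//.
have n0 : (0 < n)%N by apply: leq_trans kn; rewrite expn_gt0.
have lnn : k%:R * ln 2 <= ln (n%:R : R).
  by rewrite -ln_pow2 ler_ln ?posrE ?ltr0n ?expn_gt0// ler_nat.
have Mn : (M n)%:R <= c * k.+1%:R :> R.
  have Kk1 : (K <= k.+1)%N by lia.
  by apply: le_trans (hK k.+1 Kk1); rewrite ler_nat; apply: Mmono; exact: ltnW.
rewrite -EFinD lee_fin ler_pdivrMr ?(lt_le_trans _ lnn) ?mulr_gt0//.
apply: (le_trans Mn).
have ce : 0 <= c / ln 2 + e by rewrite addr_ge0 ?divr_ge0// ltW.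
apply: (le_trans _ (ler_wpM2l ce lnn)).
rewrite ler_pdivrMr ?mulr_gt0// in ck.
have -> : (c / ln 2 + e) * (k%:R * ln 2) = c * k%:R + k%:R * (e * ln 2).
  by field; rewrite gt_eqF.
by rewrite -natr1 mulrDr mulr1 lerD2l.
Unshelve. all: by end_near. Qed.

Lemma dyadic_limn_einf (M : nat -> nat) (c : R) :
  {homo M : m n / (m <= n)%N} -> 0 <= c ->
  (\forall k \near \oo, c * k%:R - 1 <= (M (2 ^ k)%N)%:R) ->
  ((c / ln 2)%:E <= limn_einf (fun n => ((M n)%:R / ln (n%:R : R))%:E))%E.
Proof.
move=> Mmono c0 [K _ hK]; apply/lee_subgt0Pr => e e0.
apply: limn_einf_ge_near.
have l2 := ln2_gt0.
(* For [K' <= k], the loss is at most [(c + 1) / (k * ln 2)], hence [e]. *)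
pose K' := (maxn K (Num.truncn ((c + 1) / (e * ln 2))).+1).
near=> n.
have [Kk kn nk] : [/\ (K' <= trunc_log 2 n)%N, (2 ^ trunc_log 2 n <= n)%N &
      (n < 2 ^ (trunc_log 2 n).+1)%N] by near: n; exact: trunc_log2_near.
move: Kk kn nk; set k := trunc_log 2 n => Kk kn nk.
rewrite geq_max in Kk; move/andP : Kk => [Kk Ck].
have k0 : 0 < k%:R :> R by rewrite ltr0n; lia.
have ck : (c + 1) / (e * ln 2) <= k%:R.
  rewrite ltW// (lt_le_trans (truncnS_gt _))// ler_nat//.
have n0 : (0 < n)%N by apply: leq_trans kn; rewrite expn_gt0.
have lnn : ln (n%:R : R) <= k.+1%:R * ln 2.
  by rewrite -ln_pow2 ler_ln ?posrE ?ltr0n ?expn_gt0// ler_nat ltnW.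
have lnn0 : 0 < ln (n%:R : R).
  rewrite ln_gt0// ltr1n (leq_trans _ kn)//.
  by rewrite -[X in (X < _)%N](expn0 2) ltn_exp2l//; lia.
have Mn : c * k%:R - 1 <= (M n)%:R :> R.
  by apply: (le_trans (hK k Kk)); rewrite ler_nat; exact: Mmono.
rewrite -EFinB lee_fin ler_pdivlMr//.
case: (leP (c / ln 2 - e) 0) => ce.
  by apply: (@le_trans _ _ 0) => //; rewrite mulr_le0_ge0// ltW.
apply: le_trans Mn; apply: (le_trans (ler_wpM2l (ltW ce) lnn)).
rewrite ler_pdivrMr ?mulr_gt0// in ck.
have -> : (c / ln 2 - e) * (k.+1%:R * ln 2) =
    c * k%:R + c - k%:R * (e * ln 2) - e * ln 2.
  by rewrite -natr1; field; rewrite gt_eqF.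
have : 0 < e * ln 2 by rewrite mulr_gt0.
lra.
Unshelve. all: by end_near. Qed.

End limits.

(** * Coding of words and measurability of the shift *)

Section partition.
Context d (T : measurableType d) (R : realType) (I : countType).
Variable mu : {measure set T -> \bar R}.
Local Open Scope ereal_scope.

(** The index is transported to [nat] by [pickle]; the integers outside its
    range contribute empty sets. *)
Lemma measure_fibers (f : T -> I) (B : set T) :
  (forall w, measurable (f @^-1` [set w])) -> measurable B ->
  mu B = \esum_(w in [set: I]) mu (B `&` f @^-1` [set w]).
Proof.
move=> mf mB.
pose F n := B `&` (pickle \o f) @^-1` [set n].
have F0 n : ~ range (@pickle I) n -> F n = set0.
  by move=> hn; rewrite -subset0 => x [_ /= fx]; apply: hn; exists (f x).
have Fw w : F (pickle w) = B `&` f @^-1` [set w].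
  by apply/seteqP; split=> x [Bx /= fx]; split => //=;
    [exact: (pcan_inj pickleK)|rewrite fx].
have mF n : measurable (F n).
  have [[w _ <-]|hn] := pselect (range (@pickle I) n).
    by rewrite Fw; exact: measurableI.
  by rewrite F0.
have -> : B = \bigcup_n F n.
  by apply/seteqP; split=> [x Bx|x [n _ []]//]; exists (pickle (f x)).
rewrite measure_bigcup//; last first.
  by move=> m n _ _ [x [[_ /= <-] [_ /= <-]]].
under eq_eseriesl do rewrite in_setT.
rewrite nneseries_esumT//.
transitivity (\esum_(n in range (@pickle I)) mu (F n)).
  rewrite [RHS]esum_mkcond; apply: eq_esum => n _; case: ifPn => //.
  by rewrite notin_setE => /F0 ->; rewrite measure0.
rewrite esum_image; last by move=> v w _ _; exact: (pcan_inj pickleK).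
apply: eq_esum => w _; rewrite Fw; congr (mu _).
apply/seteqP; split=> x.
  by move=> [Bx fx]; split => //; exists (pickle (f x)).
by move=> [[n _ []]].
Qed.

End partition.

Definition determined (A : Type) (n : nat) (B : set (nat -> A)) : Prop :=
  forall x y, (forall k, (k < n)%N -> x k = y k) -> B x -> B y.

Definition shiftn (A : Type) (i : nat) (x : nat -> A) : nat -> A :=
  fun k => x (i + k)%N.

Lemma iter_left_shift (A : Type) (i : nat) :
  iter i (@left_shift A) = shiftn i.
Proof.
elim: i => [|i IH]; first by apply/funext.
apply/funext => x; rewrite iterS IH; apply/funext => k.
by rewrite /left_shift /shiftn addnS.
Qed.

Lemma shiftnD (A : Type) (i j : nat) (x : nat -> A) :
  shiftn i (shiftn j x) = shiftn (j + i) x.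
Proof. by apply/funext => k; rewrite /shiftn addnA. Qed.

Lemma determined_shiftn (A : Type) (i n : nat) (B : set (nat -> A)) :
  determined n B -> determined (i + n) (shiftn i @^-1` B).
Proof.
move=> dB x y xy; apply: dB => k kn; apply: xy; by rewrite ltn_add2l.
Qed.

Lemma determined_cylinder (A : Type) n (y : nat -> A) :
  determined n (cylinder n y).
Proof. by move=> x z xz hx k kn /=; rewrite -xz// hx. Qed.

(** The nonempty fibers of [code e r] are the cylinders of length [r]
    ([code_fiber]): summing over their codes in [nat], or over pairs of codes,
    replaces sums over sets of cylinders. *)
Definition code (A : Type) (e : A -> nat) (r : nat) (x : nat -> A) : nat :=
  pickle [seq e (x k) | k <- iota 0 r].

Section coding.
Variables (A : Type) (e : A -> nat).
Hypothesis e_inj : injective e.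

Lemma code_eq r (x y : nat -> A) :
  code e r x = code e r y <-> forall k, (k < r)%N -> x k = y k.
Proof.
split=> [/(pcan_inj pickleK) /eq_in_map h k kr|h].
  by apply: e_inj; apply: h; rewrite mem_iota.
by congr pickle; apply/eq_in_map => k; rewrite mem_iota => /h ->.
Qed.

Lemma code_fiber r (y : nat -> A) :
  code e r @^-1` [set code e r y] = cylinder r y.
Proof. by apply/seteqP; split=> x /= /code_eq. Qed.

Lemma determined_code r w : determined r (code e r @^-1` [set w]).
Proof. by move=> x y /code_eq /= ->. Qed.

(** An event that depends on the first [r] letters is a union of cylinders of
    length [r], and there are countably many of them. *)
Lemma cylinder_algebra_determined r (B : set (nat -> A)) :
  determined r B -> cylinder_algebra r B.
Proof.
move=> dB; rewrite /cylinder_algebra.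
pose G w : set (nat -> A) := B `&` code e r @^-1` [set w].
have -> : B = \bigcup_w G w.
  by apply/seteqP; split=> [x Bx|x [n _ []]//]; exists (code e r x).
apply: sigma_algebra_bigcup => w.
have [[x [Bx <-]]|h] := pselect (exists x, B x /\ code e r x = w).
  apply: sub_sigma_algebra; exists x => //; rewrite -code_fiber /G.
  apply/seteqP; split=> z /=; last by case.
  by move=> zx; split => //; apply: dB Bx; apply/code_eq.
suff -> : G w = set0 by exact: sigma_algebra0.
by rewrite -subset0 => x [Bx /= cx]; apply: h; exists x.
Qed.

End coding.

Section shift_measurability.
Variables (A : pointedType) (e : A -> nat).
Hypothesis e_inj : injective e.

Lemma measurable_determined r (B : set (shift_space A)) :
  determined r B -> measurable B.
Proof.
move=> /(cylinder_algebra_determined e_inj); apply: sub_sigma_algebra2.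
by move=> C hC; exists r.
Qed.

Lemma measurable_shiftn i :
  measurable_fun setT (shiftn i : shift_space A -> shift_space A).
Proof.
apply: (@measurability _ _ (shift_space A) (shift_space A) setT _
  (\bigcup_n @cylinders A n)) => //.
move=> _ [_ [n _ [y _ <-]] <-]; rewrite setTI.
exact: measurable_determined (determined_shiftn (@determined_cylinder _ _ _)).
Qed.

Lemma measurable_preimage_shiftn i (B : set (shift_space A)) :
  measurable B -> measurable (shiftn i @^-1` B : set (shift_space A)).
Proof. by move=> mB; rewrite -[X in measurable X]setTI; exact: measurable_shiftn. Qed.

Lemma shift_invariant_iter (R : realType) (P : probability (shift_space A) R) :
  shift_invariant P -> forall i (B : set (shift_space A)), measurable B ->
  P (shiftn i @^-1` B) = P B.
Proof.
move=> invP; elim=> [|i IH] B mB; first by congr (P _).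
rewrite -(IH B mB) -(invP (shiftn i @^-1` B)); last
  exact: measurable_preimage_shiftn.
congr (P _); apply/seteqP; split=> x /=; rewrite /left_shift /shiftn;
  by under eq_fun do rewrite addSnnS.
Qed.

End shift_measurability.

(** * Sums over pairs of words *)

Section esum_extra.
Context {R : realType} {T : choiceType}.
Local Open Scope ereal_scope.

Lemma esumZl (a : T -> \bar R) (c : R) : (0 <= c)%R -> (forall i, 0 <= a i) ->
  \esum_(i in [set: T]) (c%:E * a i) = c%:E * \esum_(i in [set: T]) a i.
Proof.
have le (k : R) (b : T -> \bar R) : (0 <= k)%R -> (forall i, 0 <= b i) ->
    \esum_(i in [set: T]) (k%:E * b i) <= k%:E * \esum_(i in [set: T]) b i.
  move=> k0 b0; apply: ge_ereal_sup => _ [X XT <-].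
  rewrite -ge0_mule_fsumr//; apply: lee_wpmul2l; first by rewrite lee_fin.
  by apply: esum_ge; exists X.
move=> c0 a0; apply/eqP; rewrite eq_le le//=.
have [->|cn0] := eqVneq c 0%R.
  by rewrite mul0e esum_ge0// => i _; rewrite mul0e.
have ci0 : (0 <= c^-1)%R by rewrite invr_ge0.
have h := le (c^-1)%R (fun i => c%:E * a i) ci0.
have -> : \esum_(i in [set: T]) a i =
    \esum_(i in [set: T]) ((c^-1)%:E * (c%:E * a i)).
  by apply: eq_esum => i _; rewrite muleA -EFinM mulVf// mul1e.
apply: le_trans (lee_wpmul2l _ (h _)) _ => //.
  by move=> i; rewrite mule_ge0.
by rewrite muleA -EFinM mulfV// mul1e.
Qed.

End esum_extra.

Lemma esum_pair (R : realType) (T1 T2 : choiceType) (a : T1 -> T2 -> \bar R) :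
  (forall i j, (0 <= a i j)%E) ->
  \esum_(w in [set: T1 * T2]) a w.1 w.2 =
  \esum_(i in [set: T1]) \esum_(j in [set: T2]) a i j.
Proof.
move=> a0; rewrite esum_esum//; congr esum.
by apply/seteqP; split.
Qed.

Lemma esum_pair_swap (R : realType) (T1 T2 : choiceType)
    (a : T1 -> T2 -> \bar R) :
  (forall i j, (0 <= a i j)%E) ->
  \esum_(w in [set: T1 * T2]) a w.1 w.2 =
  \esum_(j in [set: T2]) \esum_(i in [set: T1]) a i j.
Proof.
move=> a0; rewrite -(@esum_pair _ _ _ (fun j i => a i j))//.
rewrite (reindex_esum [set: T2 * T1] _ (fun w => (w.2, w.1)))//; split=> //.
  by move=> [i j] [k l] _ _ /= [-> ->].
by move=> [i j] _; exists (j, i).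
Qed.

(** In this section [a] is the law of one word and [X], [Y] are the joint laws
    of the words at two positions, in the first and in the second point
    respectively; [X] exceeds the product of its marginals by at most a factor
    [1 + theta] and an additive error [beta]. The sum of [X * Y] is then
    the probability of two simultaneous matches. *)
Section joint_weights.
Context {R : realType} {I : choiceType}.
Variables (a : I -> R) (S theta beta : R) (X Y : I -> I -> R).
Hypothesis a0 : forall u, 0 <= a u.
Hypothesis a1 : \esum_(u in [set: I]) (a u)%:E = 1%E.
Hypothesis aS : \esum_(u in [set: I]) (a u ^+ 2)%:E = S%:E.
Hypothesis theta0 : 0 <= theta.
Hypothesis beta0 : 0 <= beta.
Hypothesis Y0 : forall u v, 0 <= Y u v.
Hypothesis Yl : forall u, \esum_(v in [set: I]) (Y u v)%:E = (a u)%:E.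
Hypothesis Yr : forall v, \esum_(u in [set: I]) (Y u v)%:E = (a v)%:E.
Hypothesis Xmix : forall u v, X u v <= (1 + theta) * (a u * a v) + beta.

Let S0 : 0 <= S.
Proof. by rewrite -lee_fin -aS esum_ge0// => u _; rewrite lee_fin sqr_ge0. Qed.

Lemma joint_total : \esum_(w in [set: I * I]) (Y w.1 w.2)%:E = 1%E.
Proof.
rewrite (@esum_pair _ _ _ (fun u v => (Y u v)%:E))//.
by under eq_esum do rewrite Yl.
Qed.

Lemma joint_sum_mix :
  (\esum_(w in [set: I * I]) (X w.1 w.2 * Y w.1 w.2)%:E <=
   (1 + theta)%:E * (\esum_(w in [set: I * I]) (a w.1 * a w.2 * Y w.1 w.2)%:E)
   + beta%:E)%E.
Proof.
have t1 : 0 <= 1 + theta by rewrite addr_ge0.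
apply: (@le_trans _ _ (\esum_(w in [set: I * I])
   ((1 + theta)%:E * (a w.1 * a w.2 * Y w.1 w.2)%:E +
     beta%:E * (Y w.1 w.2)%:E))%E).
  apply: le_esum => -[u v] _ /=; rewrite -!EFinM -EFinD lee_fin.
  by rewrite mulrA -mulrDl ler_wpM2r.
rewrite esumD; last first.
- by move=> w _; rewrite -EFinM lee_fin mulr_ge0.
- by move=> w _; rewrite -EFinM lee_fin !mulr_ge0.
rewrite !esumZl//; try by move=> w; rewrite lee_fin ?mulr_ge0.
by rewrite joint_total mule1.
Qed.

(** Apply the mixing bound to [X], then to [Y]; the error terms are summable
    because [Y] and the products [a u * a v] have total mass [1]. *)
Lemma joint_sum_full :
  (forall u v, Y u v <= (1 + theta) * (a u * a v) + beta) ->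
  (\esum_(w in [set: I * I]) (X w.1 w.2 * Y w.1 w.2)%:E <=
   ((1 + theta) ^+ 2 * S ^+ 2 + (2 + theta) * beta)%:E)%E.
Proof.
move=> Ymix; apply: (le_trans joint_sum_mix).
have t1 : 0 <= 1 + theta by rewrite addr_ge0.
have -> : (1 + theta) ^+ 2 * S ^+ 2 + (2 + theta) * beta =
  (1 + theta) * ((1 + theta) * S ^+ 2 + beta) + beta by ring.
rewrite [leRHS]EFinD EFinM; apply: leeD2r.
apply: lee_wpmul2l; first by rewrite lee_fin.
have aa : \esum_(w in [set: I * I]) (a w.1 * a w.2)%:E = 1%E.
  rewrite (@esum_pair _ _ _ (fun u v => (a u * a v)%:E)); last first.
    by move=> u v; rewrite /= lee_fin mulr_ge0.
  rewrite -[RHS]a1; apply: eq_esum => u _; under eq_esum do rewrite EFinM.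
  by rewrite esumZl// ?a1 ?mule1// => v; rewrite lee_fin.
have aa2 : \esum_(w in [set: I * I]) (a w.1 ^+ 2 * a w.2 ^+ 2)%:E = (S ^+ 2)%:E.
  rewrite (@esum_pair _ _ _ (fun u v => (a u ^+ 2 * a v ^+ 2)%:E)); last first.
    by move=> u v; rewrite /= lee_fin mulr_ge0 ?exprn_ge0.
  transitivity (\esum_(u in [set: I]) (S%:E * (a u ^+ 2)%:E))%E.
    apply: eq_esum => u _; under eq_esum do rewrite EFinM.
    rewrite esumZl ?exprn_ge0// ?aS 1?muleC// => v.
    by rewrite lee_fin exprn_ge0.
  by rewrite esumZl ?aS// => v; rewrite lee_fin exprn_ge0.
apply: (@le_trans _ _ (\esum_(w in [set: I * I])
   ((1 + theta)%:E * (a w.1 ^+ 2 * a w.2 ^+ 2)%:E + beta%:E * (a w.1 * a w.2)%:E))%E).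
  apply: le_esum => -[u v] _ /=; rewrite -!EFinM -EFinD lee_fin.
  have : 0 <= a u * a v by rewrite mulr_ge0.
  move=> /(ler_wpM2l)/(_ _ _ (Ymix u v)) => h.
  by apply: (le_trans h); rewrite le_eqVlt; apply/orP; left; apply/eqP; ring.
rewrite esumD; last first.
- by move=> w _; rewrite -EFinM lee_fin !mulr_ge0.
- by move=> w _; rewrite -EFinM lee_fin !mulr_ge0 ?exprn_ge0.
rewrite !esumZl//; try by move=> w; rewrite lee_fin mulr_ge0 ?exprn_ge0.
by rewrite aa aa2 mule1.
Qed.

Variable s : R.
Hypothesis s0 : 0 <= s.
Hypothesis sS : s ^+ 2 = S.

(** Every weight is at most [s], because its square is one term of a sum equal
    to [s ^+ 2]. *)
Lemma sum_cube_le : (\esum_(u in [set: I]) (a u ^+ 3)%:E <= (s * S)%:E)%E.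
Proof.
have as_ u : a u <= s.
  rewrite -(@ler_pXn2r _ 2)// ?nnegrE// sS -lee_fin -aS.
  rewrite -(@esum_set1 R I u (fun u => (a u ^+ 2)%:E)); last first.
    by rewrite lee_fin exprn_ge0.
  rewrite esum_mkcond; apply: le_esum => v _; case: ifPn => // _.
  by rewrite lee_fin exprn_ge0.
rewrite EFinM -aS -esumZl//; last by move=> i; rewrite lee_fin exprn_ge0.
apply: le_esum => u _; rewrite -EFinM lee_fin exprS.
by rewrite ler_wpM2r ?exprn_ge0.
Qed.

(** Since [2 * a u * a v <= a u ^+ 2 + a v ^+ 2], only the
    marginals of [Y] matter, and both of them are [a]. *)
Lemma joint_sum_near :
  (\esum_(w in [set: I * I]) (a w.1 * a w.2 * Y w.1 w.2)%:E <= (s * S)%:E)%E.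
Proof.
apply: le_trans sum_cube_le.
pose f u v : \bar R := (a u ^+ 2 * Y u v)%:E.
pose g u v : \bar R := (a v ^+ 2 * Y u v)%:E.
have f0 u v : (0 <= f u v)%E by rewrite lee_fin mulr_ge0 ?exprn_ge0.
have g0 u v : (0 <= g u v)%E by rewrite lee_fin mulr_ge0 ?exprn_ge0.
apply: (@le_trans _ _ (\esum_(w in [set: I * I])
   ((2^-1)%:E * (f w.1 w.2 + g w.1 w.2)))%E).
  apply: le_esum => -[u v] _ /=; rewrite /f /g -EFinD -EFinM lee_fin -mulrDl.
  rewrite mulrA ler_wpM2r//; have := sqr_ge0 (a u - a v); nra.
rewrite esumZl//; last by move=> w; rewrite adde_ge0.
rewrite esumD//.
rewrite (@esum_pair _ _ _ f)// (@esum_pair_swap _ _ _ g)//.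
have -> : \esum_(u in [set: I]) \esum_(v in [set: I]) f u v =
    \esum_(u in [set: I]) (a u ^+ 3)%:E.
  apply: eq_esum => u _; rewrite /f; under eq_esum do rewrite EFinM.
  by rewrite esumZl ?exprn_ge0// ?Yl -?EFinM -?exprSr// => v; rewrite lee_fin.
have -> : \esum_(v in [set: I]) \esum_(u in [set: I]) g u v =
    \esum_(u in [set: I]) (a u ^+ 3)%:E.
  apply: eq_esum => v _; rewrite /g; under eq_esum do rewrite EFinM.
  by rewrite esumZl ?exprn_ge0// ?Yr -?EFinM -?exprSr// => u; rewrite lee_fin.
set E := esum _ _.
have -> : (E + E = 2%:E * E)%E by rewrite mule_natl mule2n.
by rewrite muleA -EFinM mulVf// mul1e.
Qed.

Lemma joint_sum_half :
  (\esum_(w in [set: I * I]) (X w.1 w.2 * Y w.1 w.2)%:E <=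
   ((1 + theta) * (s * S) + beta)%:E)%E.
Proof.
apply: (le_trans joint_sum_mix).
rewrite [leRHS]EFinD EFinM; apply: leeD2r.
by apply: lee_wpmul2l joint_sum_near; rewrite lee_fin addr_ge0.
Qed.

End joint_weights.

(** * Probabilities of matches *)

Section coincidence.
Context d1 d2 (T1 : measurableType d1) (T2 : measurableType d2).
Context (R : realType) (I : countType).
Variables (m1 : probability T1 R) (m2 : probability T2 R).
Variables (f : T1 -> I) (g : T2 -> I).
Hypothesis mf : forall w, measurable (f @^-1` [set w]).
Hypothesis mg : forall w, measurable (g @^-1` [set w]).

Let coincidenceE : [set xy | f xy.1 = g xy.2] =
  \bigcup_w (f @^-1` [set w] `*` g @^-1` [set w]).
Proof.
apply/seteqP; split=> [[x y] /= fg|[x y] [w _ [/= -> ->]]//].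
by exists (f x) => //=; split.
Qed.

Lemma measurable_coincidence : measurable [set xy | f xy.1 = g xy.2].
Proof.
rewrite coincidenceE; apply: countable_bigcupT_measurable => // w.
exact: measurableX.
Qed.

(** The event is the disjoint union, over the common value [w], of the
    rectangles on which both functions are equal to [w]. *)
Lemma measure_coincidence : (m1 \x m2)%E [set xy | f xy.1 = g xy.2] =
  \esum_(w in [set: I]) (m1 (f @^-1` [set w]) * m2 (g @^-1` [set w]))%E.
Proof.
rewrite (@measure_fibers _ _ _ _ (m1 \x m2)%E (fun xy => f xy.1)).
- apply: eq_esum => w _; rewrite -product_measure1E//; congr (_ _).
  apply/seteqP; split=> [[x y] /= [<- <-]//|[x y] /= [-> ->]//].
- move=> w.
  have -> : (fun xy : T1 * T2 => f xy.1) @^-1` [set w] =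
      (f @^-1` [set w] `*` [set: T2]).
    by apply/seteqP; split=> [[x y]|[x y] []].
  exact: measurableX.
- exact: measurable_coincidence.
Qed.

End coincidence.

Definition within_gap (gap i j : nat) : bool :=
  ~~ ((i + gap <= j) || (j + gap <= i))%N.

Section shift_probability.
Context {R : realType} {A : pointedType} {e : A -> nat}.
Hypothesis e_inj : injective e.
Variable P : probability (shift_space A) R.
Hypothesis invP : shift_invariant P.

(** By definition of the Renyi rates this is
    [expR (- (r * renyi_rate P r))]. *)
Definition collision (r : nat) : R :=
  fine (\esum_(C in @cylinders A r) (P C ^+ 2)%E).

Definition word_mass (r u : nat) : R := fine (P (code e r @^-1` [set u])).

Definition joint_mass (r i j u v : nat) : R :=
  fine (P (shiftn i @^-1` (code e r @^-1` [set u]) `&`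
           shiftn j @^-1` (code e r @^-1` [set v]))).

Definition hit (r i j : nat) : set (shift_space A * shift_space A) :=
  [set xy | code e r (shiftn i xy.1) = code e r (shiftn j xy.2)].

Lemma measurable_code r u :
  measurable (code e r @^-1` [set u] : set (shift_space A)).
Proof. exact: (measurable_determined e_inj (@determined_code _ _ e_inj r u)). Qed.
Hint Resolve measurable_code : core.

Lemma measurable_code_shift r i u :
  measurable (shiftn i @^-1` (code e r @^-1` [set u]) : set (shift_space A)).
Proof. exact: (measurable_preimage_shiftn e_inj). Qed.
Hint Resolve measurable_code_shift : core.

Lemma massE r u : P (code e r @^-1` [set u]) = (word_mass r u)%:E.
Proof. by rewrite fineK// fin_num_measure. Qed.

Lemma mass_shift r i u :
  P (shiftn i @^-1` (code e r @^-1` [set u])) = (word_mass r u)%:E.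
Proof. by rewrite (shift_invariant_iter e_inj)// massE. Qed.

Lemma jointE r i j u v :
  P (shiftn i @^-1` (code e r @^-1` [set u]) `&`
     shiftn j @^-1` (code e r @^-1` [set v])) = (joint_mass r i j u v)%:E.
Proof. by rewrite fineK// fin_num_measure//; exact: measurableI. Qed.

Lemma mass_ge0 r u : 0 <= word_mass r u.
Proof. by apply: fine_ge0; exact: measure_ge0. Qed.

Lemma joint_ge0 r i j u v : 0 <= joint_mass r i j u v.
Proof. by apply: fine_ge0; exact: measure_ge0. Qed.

Lemma jointC r i j u v : joint_mass r i j u v = joint_mass r j i v u.
Proof. by rewrite /joint_mass setIC. Qed.

Lemma mass_sum r : \esum_(u in [set: nat]) (word_mass r u)%:E = 1%E.
Proof.
rewrite -(@probability_setT _ _ _ P) (measure_fibers _ (measurable_code r))//.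
by apply: eq_esum => u _; rewrite setTI; exact/esym/massE.
Qed.

Lemma joint_left r i j u :
  \esum_(v in [set: nat]) (joint_mass r i j u v)%:E = (word_mass r u)%:E.
Proof.
rewrite -(mass_shift r i) (measure_fibers _ (measurable_code_shift r j))//.
by apply: eq_esum => v _; exact/esym/jointE.
Qed.

Lemma joint_right r i j v :
  \esum_(u in [set: nat]) (joint_mass r i j u v)%:E = (word_mass r v)%:E.
Proof.
by under eq_esum do rewrite jointC; exact: joint_left.
Qed.

(** The codes that encode no word have mass [0] and do not contribute. *)
Lemma esum_word_mass_sqr r :
  \esum_(u in [set: nat]) (word_mass r u ^+ 2)%:E =
  \esum_(C in @cylinders A r) (P C ^+ 2)%E.
Proof.
pose cell u : set (nat -> A) := code e r @^-1` [set u].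
have -> : @cylinders A r = cell @` [set u | cell u !=set0].
  apply/seteqP; split=> [_ [y _ <-]|_ [u [y <-] <-]].
    by exists (code e r y); [exists y|exact: code_fiber].
  by exists y => //; rewrite -(code_fiber e_inj).
rewrite esum_image; last first.
  move=> u v; rewrite !inE => -[x /= <-] _ uv.
  by have : cell v x by rewrite -uv.
rewrite [RHS]esum_mkcond; apply: eq_esum => u _; rewrite massE.
case: ifPn => [_|]; first by rewrite expe2 -EFinM.
rewrite notin_setE => /nonemptyPn cu0.
by rewrite /word_mass -/(cell u) cu0 measure0 expr0n.
Qed.

Lemma collisionE r :
  \esum_(u in [set: nat]) (word_mass r u ^+ 2)%:E = (collision r)%:E.
Proof.
rewrite esum_word_mass_sqr fineK// -esum_word_mass_sqr ge0_fin_numE; last first.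
  by apply: esum_ge0 => u _; rewrite lee_fin exprn_ge0// mass_ge0.
apply: le_lt_trans (ltry 1); rewrite -(mass_sum r); apply: le_esum => u _.
rewrite lee_fin expr2 ler_piMr ?mass_ge0// -lee_fin -massE.
by rewrite probability_le1.
Qed.

(** Otherwise every cylinder of length [r] would be negligible, although
    countably many of them cover the space. *)
Lemma collision_gt0 r : 0 < collision r.
Proof.
have S0 : 0 <= collision r.
  by rewrite -lee_fin -collisionE esum_ge0// => u _; rewrite lee_fin sqr_ge0.
rewrite lt_neqAle S0 andbT; apply/eqP => S00.
have mass0 u : word_mass r u = 0.
  apply/eqP; rewrite -sqrf_eq0 eq_le sqr_ge0 andbT -lee_fin S00 -collisionE.
  rewrite -(@esum_set1 R _ u (fun u => (word_mass r u ^+ 2)%:E)); last first.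
    by rewrite lee_fin sqr_ge0.
  rewrite esum_mkcond; apply: le_esum => v _; case: ifPn => // _.
  by rewrite lee_fin sqr_ge0.
have := mass_sum r; rewrite esum1 => [/eqP|u _]; last by rewrite mass0.
by rewrite eqe eq_sym oner_eq0.
Qed.

Lemma measurable_hit r i j : measurable (hit r i j).
Proof.
by apply: (@measurable_coincidence _ _ (shift_space A) (shift_space A) _
  (code e r \o shiftn i) (code e r \o shiftn j)) => u;
  exact: measurable_code_shift.
Qed.

Lemma measure_hit r i j : (P \x P)%E (hit r i j) = (collision r)%:E.
Proof.
rewrite (@measure_coincidence _ _ _ _ _ _ P P
  (code e r \o shiftn i) (code e r \o shiftn j)).
- rewrite -collisionE; apply: eq_esum => u _.
  by rewrite expr2 EFinM; congr (_ * _)%E; exact: mass_shift.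
- by move=> u; exact: measurable_code_shift.
- by move=> u; exact: measurable_code_shift.
Qed.

Lemma measure_hitI r i i' j j' :
  (P \x P)%E (hit r i j `&` hit r i' j') =
  \esum_(w in [set: nat * nat])
    (joint_mass r i i' w.1 w.2 * joint_mass r j j' w.1 w.2)%:E.
Proof.
pose f i i' (x : shift_space A) := (code e r (shiftn i x), code e r (shiftn i' x)).
have mf i0 i0' w : measurable (f i0 i0' @^-1` [set w]).
  have -> : f i0 i0' @^-1` [set w] =
      shiftn i0 @^-1` (code e r @^-1` [set w.1]) `&`
      shiftn i0' @^-1` (code e r @^-1` [set w.2]).
    by case: w => u v; rewrite /f; apply/seteqP; split=> x /= [<- <-].
  exact: measurableI.
have -> : hit r i j `&` hit r i' j' = [set xy | f i i' xy.1 = f j j' xy.2].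
  by apply/seteqP; split=> [xy [/= h1 h2]|xy [h1 h2]]; rewrite /f ?h1 ?h2.
rewrite measure_coincidence//; apply: eq_esum => -[u v] _ /=.
rewrite EFinM -!jointE.
by congr (P _ * P _)%E; rewrite /f; apply/seteqP; split=> x /= [<- <-].
Qed.

(** Additive ([theta = 0]) and multiplicative ([beta = 0]) mixing are
    treated at once; [g] is the gap from which the bound holds. *)
Definition mixing_error (g : nat) (theta beta : R) : Prop :=
  forall (m n k : nat) (E F : set (shift_space A)), (g <= k)%N ->
    cylinder_algebra n E -> cylinder_algebra m F ->
    (P (E `&` iter (k + n) (@left_shift A) @^-1` F) <=
       (1 + theta)%:E * (P E * P F) + beta%:E)%E.

(** By invariance the first word may be moved to position [0], where it is an
    event of the cylinder algebra of length [r]. *)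
Lemma joint_mix g theta beta r i j u v : mixing_error g theta beta ->
  (i + (g + r) <= j)%N ->
  joint_mass r i j u v <= (1 + theta) * (word_mass r u * word_mass r v) + beta.
Proof.
move=> mix ij; rewrite -lee_fin -jointE EFinD 2!EFinM -!massE.
have rij : (r <= j - i)%N by lia.
rewrite (_ : _ `&` _ = shiftn i @^-1` (code e r @^-1` [set u] `&`
   iter ((j - i - r) + r) (@left_shift A) @^-1` (code e r @^-1` [set v]))).
  rewrite iter_left_shift (shift_invariant_iter e_inj)//; last first.
    by apply: measurableI => //; exact: (measurable_preimage_shiftn e_inj).
  have := mix r r (j - i - r)%N (code e r @^-1` [set u]) (code e r @^-1` [set v]).
  rewrite iter_left_shift; apply; first lia.
    exact: (cylinder_algebra_determined e_inj (@determined_code _ _ e_inj r u)).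
  exact: (cylinder_algebra_determined e_inj (@determined_code _ _ e_inj r v)).
rewrite iter_left_shift subnK//; apply/seteqP.
have jE : j = (i + (j - i))%N by lia.
by split=> x /=; rewrite shiftnD -jE.
Qed.

Lemma joint_mix_sym g theta beta r i j u v : mixing_error g theta beta ->
  (i + (g + r) <= j)%N || (j + (g + r) <= i)%N ->
  joint_mass r i j u v <= (1 + theta) * (word_mass r u * word_mass r v) + beta.
Proof.
move=> mix /orP[|] ij; first exact: joint_mix mix ij.
by rewrite jointC [word_mass r u * _]mulrC; exact: joint_mix mix ij.
Qed.

(** The right-hand side sums the bounds of all the configurations that may
    occur, so that it can be added up over all positions without splitting the
    sum. *)
Lemma measure_hitI_le g theta beta r i i' j j' :
  0 <= theta -> 0 <= beta -> mixing_error g theta beta ->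
  ((P \x P)%E (hit r i j `&` hit r i' j') <=
   ((1 + theta) ^+ 2 * collision r ^+ 2 + (2 + theta) * beta +
    ((within_gap (g + r) i i')%:R + (within_gap (g + r) j j')%:R) *
      ((1 + theta) * (Num.sqrt (collision r) * collision r)) +
    (within_gap (g + r) i i')%:R * (within_gap (g + r) j j')%:R * collision r)%:E)%E.
Proof.
move=> th0 be0 mix; set S := collision r; set s := Num.sqrt S.
have S0 : 0 <= S by exact/ltW/collision_gt0.
have s0 : 0 <= s by exact: sqrtr_ge0.
have sS : s ^+ 2 = S by rewrite sqr_sqrtr.
have t1 : 0 <= 1 + theta by rewrite addr_ge0.
have t2 : 0 <= 2 + theta by rewrite addr_ge0.
have b1 : 0 <= (1 + theta) * beta by rewrite mulr_ge0.
have main0 : 0 <= (1 + theta) ^+ 2 * S ^+ 2 by rewrite mulr_ge0 ?exprn_ge0.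
have half0 : 0 <= (1 + theta) * (s * S) by rewrite !mulr_ge0.
case nii : (within_gap _ i i'); case njj : (within_gap _ j j');
  rewrite /= ?mul1r ?addr0 ?add0r ?mul1r ?mul0r ?addr0.
- apply: (@le_trans _ _ ((P \x P)%E (hit r i j))).
    apply: le_measure; rewrite ?inE; last exact: subIsetl.
    + by apply: measurableI; exact: measurable_hit.
    + exact: measurable_hit.
  rewrite measure_hit lee_fin -/S.
  have : 0 <= (2 + theta) * beta by rewrite mulr_ge0.
  lra.
- rewrite measure_hitI.
  under eq_esum do rewrite mulrC.
  apply: le_trans (joint_sum_half (mass_ge0 r) (mass_sum r) (collisionE r)
    th0 be0 (joint_ge0 r i i') (joint_left r i i') (joint_right r i i') _ s0 sS
    (X := joint_mass r j j')) _.
    by move=> u v; apply: joint_mix_sym mix _; apply: negbFE njj.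
  rewrite lee_fin -/S; lra.
- rewrite measure_hitI.
  apply: le_trans (joint_sum_half (mass_ge0 r) (mass_sum r) (collisionE r)
    th0 be0 (joint_ge0 r j j') (joint_left r j j') (joint_right r j j') _ s0 sS
    (X := joint_mass r i i')) _.
    by move=> u v; apply: joint_mix_sym mix _; apply: negbFE nii.
  rewrite lee_fin -/S; lra.
- rewrite measure_hitI.
  apply: (joint_sum_full (mass_ge0 r) (mass_sum r) (collisionE r)
    th0 be0 (joint_ge0 r j j') (joint_left r j j')).
    by move=> u v; apply: joint_mix_sym mix _; apply: negbFE nii.
  by move=> u v; apply: joint_mix_sym mix _; apply: negbFE njj.
Qed.

End shift_probability.

(** * The second moment method *)

Section second_moment.
Context d (T : measurableType d) (R : realType).
Variable mu : probability T R.

Lemma integral_weighted_indic (J : finType) (F : J -> set T) (c : J -> R) :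
  (forall j, measurable (F j)) -> (forall j, 0 <= c j) ->
  (\int[mu]_x (\sum_j c j * \1_(F j) x)%:E = \sum_j (c j)%:E * mu (F j))%E.
Proof.
move=> mF c0.
have mcF j : measurable_fun setT (EFin \o (fun x => c j * \1_(F j) x) : T -> \bar R).
  by apply/measurable_EFinP; apply: measurable_funM => //; exact: measurable_indic.
under eq_integral do rewrite -sumEFin.
rewrite ge0_integral_sum//; last first.
  by move=> j x _; rewrite lee_fin mulr_ge0.
apply: eq_bigr => j _; under eq_integral do rewrite EFinM.
rewrite ge0_integralZl ?lee_fin//.
- by rewrite integral_indic// setIT.
- by apply/measurable_EFinP; exact: measurable_indic.
Qed.

(** Integrate the pointwise inequality. *)
Lemma weighted_indic_le (J K : finType) (F : J -> set T) (G : K -> set T)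
    (c : J -> R) (b : K -> R) :
  (forall j, measurable (F j)) -> (forall k, measurable (G k)) ->
  (forall j, 0 <= c j) -> (forall k, 0 <= b k) ->
  (forall x, \sum_j c j * \1_(F j) x <= \sum_k b k * \1_(G k) x) ->
  (\sum_j (c j)%:E * mu (F j) <= \sum_k (b k)%:E * mu (G k))%E.
Proof.
have mw (L : finType) (H : L -> set T) (a : L -> R) :
    (forall l, measurable (H l)) ->
    measurable_fun setT (EFin \o (fun x => \sum_l a l * \1_(H l) x) : T -> \bar R).
  move=> mH; apply/measurable_EFinP.
  apply: (@measurable_sum _ _ _ _ _ _ (fun l x => a l * \1_(H l) x)) => l.
  by apply: measurable_funM => //; exact: measurable_indic.
move=> mF mG c0 b0 cb; rewrite -!integral_weighted_indic//.
apply: ge0_le_integral => //.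
- by move=> x _; rewrite lee_fin sumr_ge0// => j _; rewrite mulr_ge0.
- exact: mw.
- exact: mw.
- by move=> x _; rewrite lee_fin.
Qed.

Lemma union_bound (I : finType) (E : I -> set T) :
  (forall i, measurable (E i)) -> (mu (\bigcup_i E i) <= \sum_i mu (E i))%E.
Proof.
move=> mE.
have mU : measurable (\bigcup_i E i) by exact: fin_bigcup_measurable.
have := @weighted_indic_le unit I (fun=> \bigcup_i E i) E (fun=> 1) (fun=> 1).
rewrite big_const card_unit /= adde0 mul1e.
under eq_bigr do rewrite mul1e.
apply=> // x; rewrite big_const card_unit /= addr0 mul1r indicE.
have [/set_mem[i _ Eix]|_] := boolP (_ \in _); last first.
  by rewrite sumr_ge0// => i _; rewrite mul1r.
by rewrite (bigD1 i)//= indicE mem_set// mulr1 lerDl sumr_ge0.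
Qed.

(** With [N] the number of events that occur and [m] its mean, integrate the
    pointwise inequality
    [2 * m * N + m ^+ 2 * (N == 0) <= N ^+ 2 + m ^+ 2].
    All terms are nonnegative, so that no integrability has to be discussed. *)
Lemma second_moment (I : finType) (E : I -> set T) (p Q : R) :
  0 <= p -> (forall i, measurable (E i)) -> (forall i, mu (E i) = p%:E) ->
  (\sum_(w : I * I) mu (E w.1 `&` E w.2) <= Q%:E)%E ->
  (mu (\bigcap_i ~` E i) * ((#|I|%:R * p) ^+ 2)%:E <=
   (Q - (#|I|%:R * p) ^+ 2)%:E)%E.
Proof.
move=> p0 mE pE EQ; set m : R := _ * p; set Z := \bigcap_i ~` E i.
have m0 : 0 <= m by rewrite mulr_ge0.
have mZ : measurable Z.
  by apply: fin_bigcap_measurable => // i _; exact: measurableC.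
(* The index [inl tt] stands for the event that no [E i] occurs. *)
pose F (j : unit + I) := if j is inr i then E i else Z.
pose c (j : unit + I) : R := if j is inr i then 2 * m else m ^+ 2.
pose G (k : unit + (I * I)) := if k is inr w then E w.1 `&` E w.2 else setT.
pose b (k : unit + (I * I)) : R := if k is inr w then 1 else m ^+ 2.
have : (\sum_j (c j)%:E * mu (F j) <= \sum_k (b k)%:E * mu (G k))%E.
  apply: weighted_indic_le.
  - by case.
  - by case=> [_|w] //=; exact: measurableI.
  - by case=> [_|i] /=; rewrite ?exprn_ge0// mulr_ge0.
  - by case=> [_|i] //=; rewrite exprn_ge0.
  move=> x; rewrite !big_sumType /= !big_const !card_unit /= !addr0.
  rewrite indicT mulr1 -mulr_sumr.
  set N := \sum_i \1_(E i) x.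
  have -> : \sum_(w : I * I) 1 * \1_(E w.1 `&` E w.2) x = N ^+ 2 :> R.
    rewrite expr2 /N big_distrlr pair_big /=.
    by apply: eq_bigr => -[i j] _; rewrite mul1r indicI.
  have [Zx|Zx] := pselect (Z x).
    rewrite /N big1 ?expr0n ?mulr0 ?addr0; last first.
      by move=> i _; rewrite indicE memNset//; exact: Zx.
    by rewrite ler_piMr ?exprn_ge0// indicE; case: (_ \in _).
  rewrite [\1_Z x]indicE memNset// mulr0 add0r.
  have := sqr_ge0 (m - N); rewrite sqrrB; lra.
rewrite !big_sumType /= !big_const !card_unit /= !adde0.
rewrite probability_setT mule1.
under eq_bigr do rewrite pE -EFinM.
rewrite sumEFin big_const iter_addr_0.
under [X in (_ <= _ + X)%E]eq_bigr do rewrite mul1e.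
rewrite -(@fineK _ (mu Z)) ?fin_num_measure// => h.
have {}h := le_trans h (leeD2l _ EQ).
move: h; rewrite -!EFinM -!EFinD !lee_fin.
have -> : 2 * m * p *+ #|I| = 2 * m ^+ 2.
  by rewrite expr2 -mulr_natr {3}/m; ring.
lra.
Qed.

End second_moment.

(** * Existence and absence of matches of a given length *)

Lemma card_within_gap (N G i : nat) :
  (#|[pred u : 'I_N | within_gap G i u.+2]| <= 2 * G)%N.
Proof.
rewrite cardE -(size_map (fun u : 'I_N => (u : nat).+2)).
rewrite -(size_iota (i.+1 - G)%N (2 * G)%N); apply: uniq_leq_size.
  by rewrite map_inj_uniq ?enum_uniq// => u v [] /val_inj.
move=> _ /mapP[u + ->]; rewrite mem_enum inE /within_gap mem_iota; lia.
Qed.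

Lemma sum_within_gap (R : realType) (N G : nat) :
  \sum_(u < N) \sum_(v < N) (within_gap G u.+2 v.+2)%:R <= (2 * G * N)%:R :> R.
Proof.
under eq_bigr do rewrite -natr_sum.
rewrite -natr_sum ler_nat mulnC -[N in leqRHS]card_ord -sum_nat_const.
apply: leq_sum => u _; apply: leq_trans (card_within_gap N G u.+2).
rewrite -sum1_card [leqRHS]big_mkcond /=; apply: leq_sum => v _.
by rewrite inE; case: within_gap.
Qed.

Lemma sum_quad (R : comPzRingType) (I J : finType) (a : I -> I -> R)
    (b : J -> J -> R) :
  \sum_(z : (I * J) * (I * J)) a z.1.1 z.2.1 * b z.1.2 z.2.2 =
  (\sum_u \sum_v a u v) * (\sum_u \sum_v b u v).
Proof.
rewrite -(pair_bigA _ (fun p q => a p.1 q.1 * b p.2 q.2)) /=.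
rewrite -(pair_bigA _ (fun u v => \sum_q a u q.1 * b v q.2)) /=.
rewrite big_distrlr; apply: eq_bigr => u _; apply: eq_bigr => v _ /=.
by rewrite big_distrlr pair_big.
Qed.

Section no_match.
Context {R : realType} {A : pointedType} {e : A -> nat}.
Hypothesis e_inj : injective e.
Variable P : probability (shift_space A) R.
Hypothesis invP : shift_invariant P.

Lemma hitP r i j (xy : shift_space A * shift_space A) :
  @hit _ e r i j xy <-> match_at r i j xy.1 xy.2.
Proof. by rewrite /hit /= (code_eq e_inj). Qed.

(** Admissible positions satisfy [1 <= i <= n - r], and the word
    attached to [i] starts at the letter of index [i.+1]: for
    [u : 'I_(n - r)], counted from [0], it starts at index [u.+2]. *)
Definition no_match_set (n r : nat) : set (shift_space A * shift_space A) :=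
  \bigcap_(w : 'I_(n - r) * 'I_(n - r)) ~` @hit _ e r w.1.+2 w.2.+2.

Lemma common_match_lt_no_match_set n r (xy : shift_space A * shift_space A) :
  (common_match n xy.1 xy.2 < r)%N -> no_match_set n r xy.
Proof.
rewrite ltnNge => /negP Mr [u v] _ /= /hitP h; apply: Mr.
have := ltn_ord u; have := ltn_ord v => vn un.
by apply: (common_match_ge (i := u.+1) (j := v.+1)) => //; lia.
Qed.

Definition match_set (n r : nat) : set (shift_space A * shift_space A) :=
  \bigcup_(w : 'I_(n - r) * 'I_(n - r)) @hit _ e r w.1.+2 w.2.+2.

Lemma common_match_ge_match_set n r (xy : shift_space A * shift_space A) :
  (0 < r)%N -> (r <= common_match n xy.1 xy.2)%N -> match_set n r xy.
Proof.
move=> r0 /(common_match_geP r0)[i [j [hi hj h]]].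
have ui : (i.-1 < n - r)%N by lia.
have vj : (j.-1 < n - r)%N by lia.
exists (Ordinal ui, Ordinal vj) => //; apply/hitP => /=.
by rewrite !prednK//; lia.
Qed.

Lemma measurable_match_set n r : measurable (match_set n r).
Proof.
by apply: fin_bigcup_measurable => // w _; exact: (measurable_hit e_inj).
Qed.

Lemma measurable_no_match_set n r : measurable (no_match_set n r).
Proof.
apply: fin_bigcap_measurable => // w _; apply: measurableC.
exact: (measurable_hit e_inj).
Qed.

Lemma measure_match_set_le n r :
  ((P \x P)%E (match_set n r) <= (n%:R ^+ 2 * collision P r)%:E)%E.
Proof.
apply: (le_trans (union_bound _ _)).
  by move=> w; exact: (measurable_hit e_inj).
rewrite (eq_bigr (fun=> (collision P r)%:E)); last first.
  by move=> w _; exact: (measure_hit e_inj invP).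
rewrite sumEFin sumr_const card_prod card_ord lee_fin.
rewrite -[leLHS]mulr_natl.
rewrite ler_wpM2r ?(ltW (collision_gt0 e_inj P r))// -natrX ler_nat -mulnn.
by rewrite leq_mul// leq_subr.
Qed.

(** The second moment method for the [(n - r) ^ 2] possible matches:
    [t ^+ 4] is the inverse square of the collision probability, and
    [2 * w] bounds the proportion of pairs of neighbouring positions divided
    by the square root of the collision probability. *)
Lemma measure_no_match_set_le n r g (theta beta : R) :
  (r < n)%N -> 0 <= theta -> 0 <= beta -> mixing_error P g theta beta ->
  let t : R := (Num.sqrt (collision P r))^-1 in
  let w : R := (g + r)%:R / (n - r)%:R * t in
  ((P \x P)%E (no_match_set n r) <=
    ((2 * theta + theta ^+ 2) + (2 + theta) * beta * t ^+ 4 +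
     4 * (1 + theta) * w + 4 * w ^+ 2)%:E)%E : Prop.
Proof.
move=> rn th0 be0 mix t w.
pose S := collision P r; pose N := (n - r)%N; pose G := (g + r)%N.
have S0 : 0 < S by exact: (collision_gt0 e_inj).
have N0 : 0 < N%:R :> R by rewrite ltr0n subn_gt0.
pose s : R := Num.sqrt S.
have s0 : 0 < s by rewrite sqrtr_gt0.
have sS : S = s ^+ 2 by rewrite sqr_sqrtr// ltW.
pose c : R := \sum_(u < N) \sum_(v < N) (within_gap G u.+2 v.+2)%:R.
have c0 : 0 <= c by rewrite sumr_ge0// => u _; rewrite sumr_ge0.
have cG : c <= 2 * G%:R * N%:R by rewrite -!natrM; exact: sum_within_gap.
pose K : R := (1 + theta) ^+ 2 * S ^+ 2 + (2 + theta) * beta.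
pose H : R := (1 + theta) * (s * S).
pose Q : R := N%:R ^+ 4 * K + 2 * c * N%:R ^+ 2 * H + c ^+ 2 * S.
have EQ : (\sum_(z : ('I_N * 'I_N) * ('I_N * 'I_N)) (P \x P)
    (@hit _ e r z.1.1.+2 z.1.2.+2 `&` @hit _ e r z.2.1.+2 z.2.2.+2) <= Q%:E)%E.
  pose k (u v : 'I_N) : R := (within_gap G u.+2 v.+2)%:R.
  apply: (@le_trans _ _ (\sum_(z : ('I_N * 'I_N) * ('I_N * 'I_N))
     (K + (k z.1.1 z.2.1 + k z.1.2 z.2.2) * H +
      k z.1.1 z.2.1 * k z.1.2 z.2.2 * S)%:E)%E).
    by apply: lee_sum => z _; exact: (measure_hitI_le e_inj invP).
  rewrite sumEFin lee_fin le_eqVlt; apply/orP; left; apply/eqP.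
  (* With the constant [one] every term has the product form of [sum_quad]. *)
  have [one one1] : exists one : 'I_N -> 'I_N -> R, forall u v, one u v = 1.
    by exists (fun _ _ => 1).
  have oE : \sum_u \sum_v one u v = N%:R ^+ 2.
    under eq_bigr do under eq_bigr do rewrite one1.
    under eq_bigr do rewrite sumr_const card_ord.
    by rewrite sumr_const card_ord -[LHS]mulr_natr expr2.
  transitivity (\sum_(z : ('I_N * 'I_N) * ('I_N * 'I_N))
      (one z.1.1 z.2.1 * one z.1.2 z.2.2 * K +
       (k z.1.1 z.2.1 * one z.1.2 z.2.2 * H + one z.1.1 z.2.1 * k z.1.2 z.2.2 * H) +
       k z.1.1 z.2.1 * k z.1.2 z.2.2 * S)).
    by apply: eq_bigr => z _; rewrite !one1; ring.
  rewrite !big_split /= -!mulr_suml !sum_quad oE -/c /Q. ring.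
have := @second_moment _ _ R (P \x P)%E ('I_N * 'I_N)%type
  (fun w => @hit _ e r w.1.+2 w.2.+2) S Q (ltW S0)
  (fun w => measurable_hit e_inj r w.1.+2 w.2.+2)
  (fun w => measure_hit e_inj invP r w.1.+2 w.2.+2) EQ.
rewrite card_prod card_ord natrM.
have m0 : 0 < (N%:R * N%:R * S) ^+ 2 by rewrite exprn_gt0// !mulr_gt0.
rewrite -lee_pdivlMr//; move=> h; apply: (le_trans h).
rewrite lee_fin ler_pdivrMr//.
have wE : w = G%:R / (N%:R * s) by rewrite /w /t invfM mulrA.
have tE : t ^+ 4 = (S ^+ 2)^-1 by rewrite /t exprVn sS -exprM.
rewrite tE wE.
have -> : (2 * theta + theta ^+ 2 + (2 + theta) * beta * (S ^+ 2)^-1 +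
    4 * (1 + theta) * (G%:R / (N%:R * s)) + 4 * (G%:R / (N%:R * s)) ^+ 2) *
    (N%:R * N%:R * S) ^+ 2 =
    N%:R ^+ 4 * K + (2 * (2 * G%:R * N%:R)) * N%:R ^+ 2 * H +
    (2 * G%:R * N%:R) ^+ 2 * S - (N%:R * N%:R * S) ^+ 2.
  rewrite /K /H sS; field.
  by rewrite !gt_eqF.
rewrite lerD2r /Q; apply: lerD; first apply: lerD => //.
  have H0 : 0 <= H.
    by rewrite /H; apply: mulr_ge0; [rewrite addr_ge0|exact/ltW/mulr_gt0].
  by apply: ler_wpM2r => //; apply: ler_wpM2r; rewrite ?exprn_ge0// ler_wpM2l.
apply: ler_wpM2r; first exact: ltW.
by rewrite ler_pXn2r// nnegrE ?mulr_ge0.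
Qed.

End no_match.

(** * Exponential growth and the Borel-Cantelli lemma *)

Section exponential_growth.
Variable R : realType.
Implicit Types (u v : nat -> R) (a b : R).

(** The terms of the variance estimate are products of a few exponential rates
    in [k]; tracking only the exponents replaces explicit constants. *)
Definition expO a u : Prop :=
  exists C : R, \forall k \near \oo, `|u k| <= C * expR (a * k%:R).

Lemma expO_ge0 a u : expO a u ->
  exists2 C : R, 0 <= C & \forall k \near \oo, `|u k| <= C * expR (a * k%:R).
Proof.
move=> [C [K _ hC]]; exists `|C| => //; exists K => // k /hC h.
by apply: (le_trans h); rewrite ler_wpM2r ?expR_ge0// ler_norm.
Qed.

Lemma expOW a b u : a <= b -> expO a u -> expO b u.
Proof.
move=> ab /expO_ge0[C C0 [K _ hC]]; exists C; exists K => // k /hC h.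
by apply: (le_trans h); rewrite ler_wpM2l// ler_expR ler_wpM2r.
Qed.

Lemma expO_cst c : expO 0 (fun=> c).
Proof. by exists `|c|; apply: nearW => k; rewrite mul0r expR0 mulr1. Qed.

Lemma expO_expR a : expO a (fun k => expR (a * k%:R)).
Proof. by exists 1; apply: nearW => k; rewrite mul1r ger0_norm ?expR_ge0. Qed.

Lemma expOD a u v : expO a u -> expO a v -> expO a (fun k => u k + v k).
Proof.
move=> [C hC] [D hD]; exists (C + D); near=> k.
rewrite mulrDl (le_trans (ler_normD _ _))// lerD//.
  by near: k.
by near: k.
Unshelve. all: by end_near. Qed.

Lemma expOM a b u v : expO a u -> expO b v -> expO (a + b) (fun k => u k * v k).
Proof.
move=> [C hC] [D hD]; exists (C * D); near=> k.
rewrite mulrDl expRD normrM mulrACA ler_pM//.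
  by near: k.
by near: k.
Unshelve. all: by end_near. Qed.

Lemma expOX a u n : expO a u -> expO (a * n%:R) (fun k => u k ^+ n).
Proof.
move=> ua; elim: n => [|n IH].
  by rewrite mulr0; apply: expO_cst.
have -> : a * n.+1%:R = a + a * n%:R by rewrite -natr1 mulrDr mulr1 addrC.
by have := expOM ua IH; under eq_fun do rewrite -exprS.
Qed.

Lemma expO_le a u v : expO a v -> (\forall k \near \oo, `|u k| <= v k) ->
  expO a u.
Proof.
move=> [C hC] uv; exists C; near=> k.
apply: (@le_trans _ _ (v k)); first by near: k.
by apply: (le_trans (ler_norm _)); near: k.
Unshelve. all: by end_near. Qed.

Lemma expO_id a : 0 < a -> expO a (fun k => k%:R).
Proof.
move=> a0; exists a^-1; apply: nearW => k; rewrite ger0_norm//.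
rewrite -ler_pdivrMl ?invr_gt0// invrK.
by apply: le_trans (expR_ge1Dx _); rewrite lerDr.
Qed.

End exponential_growth.

Section borel_cantelli_expO.
Context d (T : measurableType d) (R : realType).
Variable mu : {measure set T -> \bar R}.

Lemma borel_cantelli_expO (F : nat -> set T) (a : R) (u : nat -> R) :
  (forall k, measurable (F k)) -> a < 0 -> expO a u ->
  (\forall k \near \oo, (mu (F k) <= (u k)%:E)%E) ->
  {ae mu, forall x, \forall k \near \oo, ~ F k x}.
Proof.
move=> mF a0 /expO_ge0[C C0 hC] hu.
have [K _ hK] : \forall k \near \oo, (mu (F k) <= (C * expR a ^+ k)%:E)%E.
  near=> k; apply: (@le_trans _ _ (u k)%:E); first by near: k.
  rewrite lee_fin (le_trans (ler_norm _))// -expRM_natr.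
  by near: k.
(* The finitely many events without a bound are discarded. *)
pose G k := if (K <= k)%N then F k else set0.
have mG k : measurable (G k) by rewrite /G; case: ifP.
have qlt : `|expR a| < 1 by rewrite ger0_norm ?expR_ge0// expR_lt1.
have sumG : (\sum_(k <oo) mu (G k) < +oo)%E.
  apply: (@le_lt_trans _ _ (C * (1 - expR a)^-1)%:E); last exact: ltry.
  apply: lime_le; first exact: is_cvg_nneseries.
  apply: nearW => n.
  apply: (@le_trans _ _ (\sum_(0 <= k < n) (C * expR a ^+ k)%:E)%E).
    apply: lee_sum => k _; rewrite /G; case: ifPn => Kk; first exact: hK.
    by rewrite measure0 lee_fin mulr_ge0// exprn_ge0 ?expR_ge0.
  rewrite sumEFin lee_fin.
  by have := @geometric_le_lim R n C (expR a) C0 (expR_gt0 _) qlt.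
exists (lim_sup_set G); split.
- apply: bigcap_measurable => // n _; apply: bigcup_measurable => k _.
  exact: mG.
- exact: lim_sup_set_cvg0.
move=> x /= nx n _; apply: contrapT => h; apply: nx.
exists (maxn K n) => // k /=; rewrite geq_max => /andP[Kk nk] Fk.
by apply: h; exists k => //; rewrite /G Kk.
Unshelve. all: by end_near. Qed.

End borel_cantelli_expO.

(** * Mixing rates *)

Lemma expO_truncnS (R : realType) (a : R) (f : nat -> R) :
  0 <= a -> (forall k, 0 <= f k) -> expO a f ->
  expO a (fun k => (Num.truncn (f k)).+1%:R).
Proof.
move=> a0 f0 fa.
have h1 : expO a (fun k => f k + 1).
  by apply: expOD => //; apply: expOW a0 _; exact: expO_cst.
apply: expO_le h1 _; apply: nearW => k.
by rewrite ger0_norm// -natr1 lerD2r truncn_le.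
Qed.

Section mixing_rates.
Context {R : realType} {A : pointedType} {e : A -> nat}.
Hypothesis e_inj : injective e.
Variable P : probability (shift_space A) R.

Lemma measurable_cylinder_algebra n (E : set (shift_space A)) :
  cylinder_algebra n E -> measurable E.
Proof. by apply: sub_sigma_algebra2 => C hC; exists n. Qed.

(** The exponent [5 * ln 2] makes [beta] negligible against the square of
    the collision probability, which is of order at least
    [expR (- (4 * ln 2 * k))] for the lengths [r] in use. *)
Definition fast_mixing : Prop :=
  forall delta : R, 0 < delta ->
  exists (g : nat -> nat) (theta beta : nat -> R) (kappa : R),
  [/\ forall k, [/\ 0 <= theta k, 0 <= beta k &
                    mixing_error P (g k) (theta k) (beta k)],
      0 < kappa, expO delta (fun k => (g k)%:R),
      expO (- kappa) theta & expO (- (5 * ln 2)) beta].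

Lemma correlation_le n m k (E F : set (shift_space A)) (theta beta : R) :
  cylinder_algebra n E -> cylinder_algebra m F ->
  (`|P (E `&` iter (k + n) (@left_shift A) @^-1` F) - P E * P F| <=
   theta%:E * (P E * P F) + beta%:E)%E ->
  (P (E `&` iter (k + n) (@left_shift A) @^-1` F) <=
   (1 + theta)%:E * (P E * P F) + beta%:E)%E.
Proof.
move=> /measurable_cylinder_algebra mE /measurable_cylinder_algebra mF.
have mI : measurable (E `&` iter (k + n) (@left_shift A) @^-1` F).
  apply: measurableI => //; rewrite iter_left_shift.
  exact: (measurable_preimage_shiftn e_inj).
rewrite -(@fineK _ (P E)) ?fin_num_measure//.
rewrite -(@fineK _ (P F)) ?fin_num_measure//.
rewrite -(@fineK _ (P (_ `&` _))) ?fin_num_measure//.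
rewrite -!EFinM -EFinB -!EFinD abse_EFin !lee_fin ler_norml => /andP[_].
lra.
Qed.

(** A gap proportional to [k] already gives any prescribed exponential rate. *)
Lemma exp_alpha_mixes : exp_alpha_mixing P -> fast_mixing.
Proof.
move=> [alpha [[_ mix] [C [lambda [l0 decay]]]]] delta delta0.
have l2 := ln2_gt0 R.
pose m := (Num.truncn (5 * ln 2 / lambda)).+1.
have mlambda : 5 * ln 2 <= lambda * m%:R.
  by rewrite [leRHS]mulrC -ler_pdivrMr//; exact/ltW/truncnS_gt.
exists (fun k => m * k)%N, (fun=> 0).
exists (fun k => `|C| * expR (- (lambda * m%:R) * k%:R)), 1; split => //.
- move=> k; split=> //.
  move=> m' n g E F gk mE mF; apply: (correlation_le mE mF).
  apply: le_trans (mix _ _ _ _ _ mE mF) _.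
  rewrite mul0e add0e lee_fin (le_trans (ler_norm _))// (le_trans (decay _))//.
  apply: ler_pM => //; rewrite ?expR_ge0 ?ler_norm//.
    by have := le_trans (normr_ge0 _) (decay 0%N); rewrite mulr0 oppr0 expR0 mulr1.
  by rewrite ler_expR mulNr lerN2 -mulrA -natrM ler_pM2l// ler_nat.
- under eq_fun do rewrite natrM.
  by rewrite -[delta]add0r; apply: expOM; [exact: expO_cst|exact: expO_id].
- by exists 0; apply: nearW => k; rewrite normr0 mul0r.
- have -> : - (5 * ln 2) = 0 + - (5 * ln 2) :> R by rewrite add0r.
  apply: expOM; first exact: expO_cst.
  by apply: expOW (expO_expR _); rewrite lerN2.
Qed.

(** The error decays only polynomially in the gap, so the gap has to grow
    exponentially in [k]; but its rate [delta] can be as small as desired. *)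
Lemma poly_psi_mixes : poly_psi_mixing P -> fast_mixing.
Proof.
move=> [a [a0 [_ mix]]] delta delta0.
exists (fun k => (Num.truncn (expR (delta * k%:R))).+1).
exists (fun k => expR (- (a * delta) * k%:R)), (fun=> 0), (a * delta).
split.
- move=> k; split=> //.
  move=> m n g E F gk mE mF; apply: (correlation_le mE mF).
  have g1 : (1 <= g)%N by exact: leq_ltn_trans gk.
  apply: le_trans (mix _ _ _ _ _ g1 mE mF) _.
  rewrite adde0; apply: lee_wpmul2r; first exact: mule_ge0.
  have gexp : expR (delta * k%:R) <= g%:R.
    by rewrite ltW// (lt_le_trans (truncnS_gt _))// ler_nat.
  have g0 : 0 < g%:R :> R by rewrite ltr0n.
  rewrite lee_fin /powR gt_eqF// ler_expR !mulNr lerN2 -mulrA ler_pM2l//.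
  by rewrite -(@expRK R (delta * _)) ler_ln ?posrE ?expR_gt0.
- exact: mulr_gt0.
- apply: expO_truncnS; [exact: ltW|by move=> k; exact: expR_ge0|].
  exact: expO_expR.
- exact: expO_expR.
- by exists 0; apply: nearW => k; rewrite normr0 mul0r.
Qed.

End mixing_rates.

(** * Almost sure growth of the longest match *)

Section entropy_bounds.
Context {R : realType} {A : pointedType} {e : A -> nat}.
Hypothesis e_inj : injective e.
Variable P : probability (shift_space A) R.
Hypothesis invP : shift_invariant P.

Lemma ereal_gt_between (h : R) (x : \bar R) : (h%:E < x)%E ->
  exists2 h' : R, h < h' & (h'%:E < x)%E.
Proof.
case: x => [x| |]//.
  by rewrite lte_fin => hx; exists ((h + x) / 2); rewrite ?lte_fin midf_lt.
by move=> _; exists (h + 1); rewrite ?ltry// ltrDl.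
Qed.

Lemma ereal_lt_between (h : R) (x : \bar R) : (x < h%:E)%E ->
  exists2 h' : R, h' < h & (x < h'%:E)%E.
Proof.
case: x => [x| |]//.
  by rewrite lte_fin => hx; exists ((x + h) / 2); rewrite ?lte_fin midf_lt.
by move=> _; exists (h - 1); rewrite ?ltNyr// ltrBlDr ltrDl.
Qed.

Lemma collision_lt_near (h : R) : (h%:E < lower_renyi P)%E ->
  \forall k \near \oo, collision P k <= expR (- (h * k%:R)).
Proof.
move=> /lt_limn_einf_near hk; near=> k.
have k0 : 0 < k%:R :> R by rewrite ltr0n; near: k; exists 1%N.
have : (h%:E < renyi_rate P k)%E by near: k.
rewrite /renyi_rate lte_fin -/(collision P k) invrN mulrN ltrNr ltr_pdivrMr//.
move=> /ltW h1; rewrite -mulNr -[leLHS]lnK ?ler_expR// posrE.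
exact: (collision_gt0 e_inj).
Unshelve. all: by end_near. Qed.

Lemma collision_gt_near (h : R) : (upper_renyi P < h%:E)%E ->
  \forall k \near \oo, expR (- (h * k%:R)) <= collision P k.
Proof.
move=> /limn_esup_lt_near hk; near=> k.
have k0 : 0 < k%:R :> R by rewrite ltr0n; near: k; exists 1%N.
have : (renyi_rate P k < h%:E)%E by near: k.
rewrite /renyi_rate lte_fin -/(collision P k) invrN mulrN ltrNl ltr_pdivlMr//.
move=> /ltW h1; rewrite -mulNr -[leRHS]lnK ?ler_expR// posrE.
exact: (collision_gt0 e_inj).
Unshelve. all: by end_near. Qed.

Lemma expR_ln2 k : expR (ln 2 * k%:R) = (2 ^ k)%:R :> R.
Proof. by rewrite expRM_natr lnK ?posrE// natrX. Qed.

Lemma truncn_near (c : R) (N : nat) : 0 < c ->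
  \forall k \near \oo, (N <= Num.truncn (c * k%:R))%N.
Proof.
move=> c0; exists (Num.truncn (N%:R / c)).+1 => // k /= Nk.
rewrite truncn_ge_nat; last by rewrite mulr_ge0// ltW.
rewrite [leRHS]mulrC -ler_pdivrMr// ltW// (lt_le_trans (truncnS_gt _))//.
by rewrite ler_nat.
Qed.

(** With [c = 2 * ln 2 / h], the bound
    [4 ^ k * expR (- (h' * c * k))] on the probability of a match
    decays because [h < h']. *)
Lemma ae_limn_esup_match (h : R) : 0 < h -> (h%:E < lower_renyi P)%E ->
  {ae (P \x P)%E, forall xy : shift_space A * shift_space A,
    (limn_esup (match_rate R xy.1 xy.2) <= (2 / h)%:E)%E}.
Proof.
move=> h0 /ereal_gt_between[h' hh' h'l].
have l2 := ln2_gt0 R.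
pose c : R := 2 * ln 2 / h.
have c0 : 0 < c by rewrite divr_gt0// mulr_gt0.
pose r k := (Num.truncn (c * k%:R)).+1.
pose a : R := 2 * ln 2 - h' * c.
have a0 : a < 0.
  rewrite /a /c subr_lt0 mulrCA -[ltLHS]mulr1 ltr_pM2l ?mulr_gt0//.
  by rewrite ltr_pdivlMr// mul1r.
have hF : \forall k \near \oo, ((P \x P)%E (match_set (e := e) (2 ^ k) (r k)) <=
    (expR (a * k%:R))%:E)%E.
  have [N _ hN] := collision_lt_near h'l.
  near=> k; apply: (le_trans (measure_match_set_le e_inj invP _ _)).
  rewrite lee_fin /a mulrBl expRD.
  have Nr : (N <= r k)%N by apply: leqW; near: k; exact: truncn_near.
  apply: ler_pM => //.
  - exact/ltW/(collision_gt0 e_inj).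
  - by rewrite -mulrA expRM_natl expR_ln2.
  apply: (le_trans (hN _ Nr)); rewrite ler_expR lerN2 -mulrA ler_wpM2l//.
    by rewrite ltW// (lt_trans h0).
  exact/ltW/truncnS_gt.
have := borel_cantelli_expO (fun k => measurable_match_set e_inj (2 ^ k) (r k))
  a0 (expO_expR a) hF.
apply: filterS => xy hxy.
have <- : c / ln 2 = 2 / h by rewrite /c; field; rewrite !gt_eqF.
apply: dyadic_limn_esup; [exact: common_match_mono|exact: ltW|].
near=> k.
have nF : ~ match_set (e := e) (2 ^ k) (r k) xy by near: k.
apply: (@le_trans _ _ (Num.truncn (c * k%:R))%:R); last first.
  by rewrite truncn_le mulr_ge0// ltW.
rewrite ler_nat leqNgt; apply/negP => /(common_match_ge_match_set e_inj (ltn0Sn _)).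
exact: nF.
Unshelve. all: by end_near. Qed.

(** Since [x <= expR x], the square of [ln 2 * k / 2] is at most
    [2 ^ k]. *)
Lemma linear_le_pow2 (r : nat -> nat) (c : R) :
  (forall k, (r k)%:R <= c * k%:R) ->
  \forall k \near \oo, 2 * (r k)%:R <= (2 ^ k)%:R :> R.
Proof.
move=> rc; have l2 := ln2_gt0 R.
exists (Num.truncn (8 * c / (ln 2) ^+ 2)).+1 => // k /= hk.
have rck := rc k.
(* The constant [8] makes the square of [ln 2 * k / 2] at least [2 * c * k]. *)
have kc : 8 * c / (ln 2) ^+ 2 <= k%:R.
  by rewrite ltW// (lt_le_trans (truncnS_gt _))// ler_nat.
have pk : (ln 2 * k%:R / 2) ^+ 2 <= (2 ^ k)%:R :> R.
  rewrite -expR_ln2 [in leRHS](splitr (ln 2 * k%:R)) expRD -expr2.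
  have x0 : 0 <= ln 2 * k%:R / 2 :> R by rewrite divr_ge0// mulr_ge0// ltW.
  rewrite ler_pXn2r ?nnegrE ?expR_ge0//.
  by apply: le_trans (expR_ge1Dx _); rewrite lerDr.
apply: le_trans pk.
rewrite ler_pdivrMr ?exprn_gt0// in kc.
have : 0 <= k%:R :> R by [].
nra.
Qed.

Lemma expO_inv_pow2 (r : nat -> nat) (c : R) :
  (forall k, (r k)%:R <= c * k%:R) ->
  expO (- ln 2) (fun k => ((2 ^ k - r k)%N%:R : R)^-1).
Proof.
move=> /linear_le_pow2 r2; exists 2; near=> k.
have rk2 : 2 * (r k)%:R <= (2 ^ k)%:R :> R by near: k.
have r0 : 0 <= (r k)%:R :> R by [].
have p0 : 0 < (2 ^ k)%:R :> R by rewrite ltr0n expn_gt0.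
have rk : (r k <= 2 ^ k)%N by rewrite -(@ler_nat R); lra.
rewrite mulNr expRN expR_ln2 natrB// ger0_norm ?invr_ge0; last lra.
rewrite -[leRHS]invrK lef_pV2 ?posrE; last 2 first.
- lra.
- by rewrite invr_gt0 divr_gt0.
by rewrite invfM invrK; lra.
Unshelve. all: by end_near. Qed.

(** With [c = 2 * ln 2 / h] and [rho = h' / h < 1], the collision
    probability at length [c * k] is at least
    [expR (- (2 * rho * ln 2 * k))]. The number of positions exceeds
    the inverse of its square root by a factor [expR (2 * delta * k)], of
    which the gap is allowed to use half. *)
Lemma ae_limn_einf_match (h : R) : fast_mixing P ->
  (0 < upper_renyi P)%E -> (upper_renyi P < h%:E)%E ->
  {ae (P \x P)%E, forall xy : shift_space A * shift_space A,
    ((2 / h)%:E <= limn_einf (match_rate R xy.1 xy.2))%E}.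
Proof.
move=> mix u0 /ereal_lt_between[h' hh' uh'].
have h'0 : 0 < h' by rewrite -lte_fin (lt_trans u0).
have h0 : 0 < h by rewrite (lt_trans h'0).
have l2 := ln2_gt0 R.
pose c : R := 2 * ln 2 / h.
have c0 : 0 < c by rewrite divr_gt0// mulr_gt0.
pose r k := Num.truncn (c * k%:R).
pose rho : R := h' / h.
have rho1 : rho < 1 by rewrite /rho ltr_pdivrMr// mul1r.
pose delta : R := (1 - rho) / 2 * ln 2.
have delta0 : 0 < delta by rewrite mulr_gt0// divr_gt0// subr_gt0.
have [g [theta [beta [kappa [gtb kappa0 gO thetaO betaO]]]]] := mix _ delta0.
have rc k : (r k)%:R <= c * k%:R by rewrite truncn_le mulr_ge0// ltW.
have rO : expO delta (fun k => (r k)%:R : R).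
  apply: (@expO_le _ _ _ (fun k => c * k%:R)).
    by rewrite -[delta]add0r; apply: expOM; [exact: expO_cst|exact: expO_id].
  by apply: nearW => k; rewrite ger0_norm.
pose t k : R := (Num.sqrt (collision P (r k)))^-1.
have tO : expO (rho * ln 2) t.
  apply: expO_le (expO_expR _) _.
  have [N _ hN] := collision_gt_near uh'.
  near=> k.
  have Nr : (N <= r k)%N by near: k; exact: truncn_near.
  have S0 := collision_gt0 e_inj P (r k).
  rewrite /t ger0_norm ?invr_ge0 ?sqrtr_ge0// -[leRHS]invrK -expRN.
  rewrite lef_pV2 ?posrE ?expR_gt0 ?sqrtr_gt0//.
  rewrite -(@ler_pXn2r _ 2) ?nnegrE ?expR_ge0 ?sqrtr_ge0// sqr_sqrtr ?(ltW S0)//.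
  apply: le_trans (hN _ Nr); rewrite -expRM_natl ler_expR.
  have -> : 2%:R * - (rho * ln 2 * k%:R) = - (h' * (c * k%:R)).
    by rewrite /rho /c; field; rewrite gt_eqF.
  by rewrite lerN2 ler_pM2l.
pose w k : R := (g k + r k)%:R / (2 ^ k - r k)%:R * t k.
have wO : expO (- delta) w.
  have -> : - delta = delta + - ln 2 + rho * ln 2 by rewrite /delta; field.
  apply: expOM tO; apply: expOM; last exact: expO_inv_pow2 rc.
  by under eq_fun do rewrite natrD; exact: expOD.
(* The slowest of the exponential rates of the terms of [u] below. *)
pose a : R := - Num.min kappa (Num.min delta (ln 2)).
have a0 : a < 0 by rewrite oppr_lt0 !lt_min kappa0 delta0.
have ak : - kappa <= a by rewrite lerN2 ge_min lexx.
have ad : - delta <= a by rewrite lerN2 !ge_min lexx orbT.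
have al : - ln 2 <= a by rewrite lerN2 !ge_min lexx !orbT.
have theta0O : expO 0 theta by apply: expOW thetaO; rewrite oppr_le0 ltW.
pose u k : R := (2 * theta k + theta k ^+ 2) + (2 + theta k) * beta k * t k ^+ 4 +
     4 * (1 + theta k) * w k + 4 * w k ^+ 2.
have uO : expO a u.
  apply: expOD; first apply: expOD; first apply: expOD; first apply: expOD.
  - rewrite -[a]add0r; apply: expOM; [exact: expO_cst|exact: expOW thetaO].
  - apply: expOW (expOX 2 thetaO); apply: le_trans ak; lra.
  - have le5 : 0 + - (5 * ln 2) + rho * ln 2 * 4%:R <= a.
      by apply: le_trans al; nra.
    apply: expOW le5 _; apply: expOM; last exact: expOX.
    by apply: expOM => //; apply: expOD => //; exact: expO_cst.
  - apply: expOW ad _; rewrite -[- delta]add0r; apply: expOM => //.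
    rewrite -[0]add0r; apply: expOM; first exact: expO_cst.
    by apply: expOD => //; exact: expO_cst.
  - rewrite -[a]add0r; apply: expOM; first exact: expO_cst.
    apply: expOW (expOX 2 wO); apply: le_trans ad; lra.
have hF : \forall k \near \oo,
    ((P \x P)%E (no_match_set (e := e) (2 ^ k) (r k)) <= (u k)%:E)%E.
  have r2 := linear_le_pow2 rc.
  near=> k.
  have rk : (r k < 2 ^ k)%N.
    have : 2 * (r k)%:R <= (2 ^ k)%:R :> R by near: k.
    have : 0 < (2 ^ k)%:R :> R by rewrite ltr0n expn_gt0.
    have : 0 <= (r k)%:R :> R by [].
    by rewrite -(@ltr_nat R); lra.
  by have [th0 be0 mixk] := gtb k; exact: measure_no_match_set_le.
have := borel_cantelli_expO
  (fun k => measurable_no_match_set e_inj (2 ^ k) (r k)) a0 uO hF.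
apply: filterS => xy hxy.
have <- : c / ln 2 = 2 / h by rewrite /c; field; rewrite !gt_eqF.
apply: dyadic_limn_einf; [exact: common_match_mono|exact: ltW|].
near=> k.
have nF : ~ no_match_set (e := e) (2 ^ k) (r k) xy by near: k.
apply: (@le_trans _ _ (r k)%:R).
  by rewrite lerBlDr natr1 ltW// truncnS_gt.
rewrite ler_nat leqNgt; apply/negP => /(common_match_lt_no_match_set e_inj).
exact: nF.
Unshelve. all: by end_near. Qed.

End entropy_bounds.

Section entropy_limits.
Context {R : realType} {A : pointedType}.
Variable countableA : countable [set: A].
Variable P : probability (shift_space A) R.
Hypothesis invP : shift_invariant P.

(** Almost sure bounds for each [h < x] combine over a sequence of values of
    [h]; it is chosen so that [2 / h] is exactly [2 / x] plus a vanishing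
    term, which also covers [x = +oo]. *)
Lemma div2_approx_below (x : \bar R) : (0 < x)%E ->
  exists h : nat -> R, (forall q, 0 < h q /\ ((h q)%:E < x)%E) /\
    forall L : \bar R, (forall q, (L <= (2 / h q)%:E)%E) -> (L <= 2%:E / x)%E.
Proof.
move=> x0; have [y [y0 yE xy]] : exists y : R,
    [/\ 0 <= y, (2%:E / x = y%:E)%E &
        forall z, y < z -> ((2 / z)%:E < x)%E].
  move: x x0 => [x| |]//.
    rewrite lte_fin => x0; exists (2 / x); split; first by rewrite divr_ge0// ltW.
      by rewrite inver gt_eqF.
    move=> z xz; rewrite lte_fin ltr_pdivrMr; last first.
      by apply: lt_trans xz; rewrite divr_gt0.
    by rewrite mulrC -ltr_pdivrMr.
  by move=> _; exists 0; split=> //; rewrite ?invey ?mule0// => z _; rewrite ltry.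
have q0 q : 0 < q.+1%:R^-1 :> R by rewrite invr_gt0.
exists (fun q => 2 / (y + q.+1%:R^-1)); split=> [q|L hL].
  split; last by apply: xy; rewrite ltrDl.
  by rewrite divr_gt0// ltr_wpDl.
rewrite yE; apply/lee_addgt0Pr => eps eps0.
pose q := Num.truncn (eps^-1); apply: (le_trans (hL q)).
rewrite -EFinD lee_fin invfM invrK mulrA mulfV// mul1r lerD2l.
rewrite -[leRHS]invrK lef_pV2 ?posrE ?invr_gt0//.
exact/ltW/truncnS_gt.
Qed.

Lemma div2_approx_above (x : R) : 0 < x ->
  exists h : nat -> R, (forall q, x < h q) /\
    forall L : \bar R, (forall q, ((2 / h q)%:E <= L)%E) ->
      (2%:E / x%:E <= L)%E.
Proof.
move=> x0; exists (fun q => x + q.+1%:R^-1); split=> [q|L hL].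
  by rewrite ltrDl invr_gt0.
rewrite inver gt_eqF//; apply/lee_subgt0Pr => eps eps0.
pose q := Num.truncn (2 / (eps * x ^+ 2)); apply: le_trans (hL q).
rewrite -EFinB lee_fin.
have d0 : 0 < q.+1%:R^-1 :> R by rewrite invr_gt0.
have dle : q.+1%:R^-1 <= eps * x ^+ 2 / 2.
  rewrite -[leRHS]invrK invfM invrK mulrC lef_pV2 ?posrE//.
    by apply/ltW/truncnS_gt.
  by rewrite divr_gt0// mulr_gt0// exprn_gt0.
set d : R := _^-1 in d0 dle *.
rewrite ler_pdivlMr ?addr_gt0//.
have -> : (2 / x - eps) * (x + d) = 2 + 2 * d / x - eps * x - eps * d.
  by field; rewrite gt_eqF.
have : 2 * d / x <= eps * x.
  by rewrite ler_pdivrMr// -mulrA -expr2; lra.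
have : 0 <= eps * d by rewrite mulr_ge0// ltW.
lra.
Qed.

Lemma match_rate_upper : (0 < lower_renyi P)%E ->
  {ae (P \x P)%E, forall xy : shift_space A * shift_space A,
    (limn_esup (match_rate R xy.1 xy.2) <= 2%:E / lower_renyi P)%E}.
Proof.
move=> l0; have [e /in2TT e_inj] := countable_injP _ countableA.
have [h [hl hL]] := div2_approx_below l0.
have := ae_foralln (fun q => ae_limn_esup_match e_inj invP (hl q).1 (hl q).2).
by apply: filterS => xy hxy; exact: hL.
Qed.

Lemma match_rate_ge0 (x y : nat -> A) n : (0 <= match_rate R x y n)%E.
Proof.
rewrite lee_fin divr_ge0//; case: n => [|n]; first by rewrite ln0.
by rewrite ln_ge0// ler1n.
Qed.

Lemma match_rate_lower : (0 < lower_renyi P)%E ->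
  exp_alpha_mixing P \/ poly_psi_mixing P ->
  {ae (P \x P)%E, forall xy : shift_space A * shift_space A,
    (2%:E / upper_renyi P <= limn_einf (match_rate R xy.1 xy.2))%E}.
Proof.
move=> l0 mix; have [e /in2TT e_inj] := countable_injP _ countableA.
have {}mix : fast_mixing P.
  by case: mix; [exact: exp_alpha_mixes e_inj _|exact: poly_psi_mixes e_inj _].
have u0 : (0 < upper_renyi P)%E := lt_le_trans l0 (limn_einf_sup _).
have lower := ae_limn_einf_match e_inj invP mix u0.
move: u0 lower; case: (upper_renyi P) => [x| |]//; last first.
  move=> _ _; rewrite invey mule0; apply: aeW => xy.
  by apply: limn_einf_ge_near; apply: nearW => n; exact: match_rate_ge0.
rewrite lte_fin => x0 lower; have [h [xh hL]] := div2_approx_above x0.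
have := ae_foralln (fun q => lower (h q) (xh q)).
by apply: filterS => xy hxy; exact: hL.
Qed.

Lemma cvg_limn_einf_esup (u : (\bar R)^nat) (l : \bar R) :
  (l <= limn_einf u)%E -> (limn_esup u <= l)%E -> u @ \oo --> l.
Proof.
rewrite limn_einf_lim limn_esup_lim => lu ul.
have eu := @is_cvg_einfs _ u; have su := @is_cvg_esups _ u.
have le : (limn (einfs u) <= limn (esups u))%E.
  by apply: lee_lim => //; apply: nearW; exact: einfs_le_esups.
have el : limn (einfs u) = l by apply/le_anti; rewrite lu (le_trans le).
have sl : limn (esups u) = l by apply/le_anti; rewrite ul (le_trans lu).
rewrite -el in sl *.
apply: (@squeeze_cvge _ _ _ _ (einfs u) _ (esups u)) => //; last by rewrite -sl.
apply: nearW => n; apply/andP; split.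
  by apply: ereal_inf_lbound; exists n => /=.
by apply: ereal_sup_ubound; exists n => /=.
Qed.

End entropy_limits.

Theorem theorem7 (R : realType) (A : pointedType)
    (countableA : countable [set: A])
    (P : probability (shift_space A) R) (invP : shift_invariant P) :
  [/\ (0 < lower_renyi P)%E ->
        {ae (P \x P)%E, forall xy : shift_space A * shift_space A,
          (limn_esup (match_rate R xy.1 xy.2) <= 2%:E / lower_renyi P)%E},
      (0 < lower_renyi P)%E -> exp_alpha_mixing P \/ poly_psi_mixing P ->
        {ae (P \x P)%E, forall xy : shift_space A * shift_space A,
          (2%:E / upper_renyi P <= limn_einf (match_rate R xy.1 xy.2))%E} &
      (0 < lower_renyi P)%E -> exp_alpha_mixing P \/ poly_psi_mixing P ->
        cvgn (renyi_rate P) ->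
        {ae (P \x P)%E, forall xy : shift_space A * shift_space A,
          match_rate R xy.1 xy.2 @ \oo --> (2%:E / renyi P)%E}].
Proof.
split; [exact: match_rate_upper|exact: match_rate_lower|move=> l0 mix cv].
have upper := match_rate_upper countableA invP l0.
have lower := match_rate_lower countableA invP l0 mix.
rewrite /lower_renyi is_cvg_limn_einfE// in upper.
rewrite /upper_renyi is_cvg_limn_esupE// in lower.
by apply: filterS2 upper lower => xy up low; exact: cvg_limn_einf_esup.
Qed.
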